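(* Let Assumptions 1, 2 and 3 (in the context) hold. Suppose that there are processes $T^{1*},T^{2*}\in L^\infty_{\mathbb F}(\overline{\mathcal T};\mathbb S^n_+)$, $\Pi^{1*}\in\mathcal Q^1(\mathcal T)$, $\Pi^{2*}\in\mathcal Q^2(\mathcal T)$ solving the cross-coupled stochastic Riccati equations, for all $k\in\mathcal T$, $$\begin{cases}T^{1*}_k=\Delta(T^{1*}_{k+1},\Pi^{2*}_k)-\Lambda(T^{1*}_{k+1},\Pi^{2*}_k)^\top\Upsilon^{-1}(T^{1*}_{k+1})\Lambda(T^{1*}_{k+1},\Pi^{2*}_k),\\ \Pi^{1*}_k=-\Upsilon^{-1}(T^{1*}_{k+1})\Lambda(T^{1*}_{k+1},\Pi^{2*}_k),\qquad T^{1*}_N=G_N,\end{cases}$$ $$\begin{cases}T^{2*}_k=\Delta(T^{2*}_{k+1},\Pi^{1*}_k)-\Lambda(T^{2*}_{k+1},\Pi^{1*}_k)^\top\Upsilon^{-1}(T^{2*}_{k+1})\Lambda(T^{2*}_{k+1},\Pi^{1*}_k),\\ \Pi^{2*}_k=-\Upsilon^{-1}(T^{2*}_{k+1})\Lambda(T^{2*}_{k+1},\Pi^{1*}_k),\qquad T^{2*}_N=H_N,\end{cases}$$ which are strongly regular, i.e. there is a constant $\delta>0$ such that $\Upsilon(T^{1*}_{k+1})\succ\delta I$ and $\Upsilon(T^{2*}_{k+1})\succ\delta I$ for all $k\in\mathcal T$. Suppose also that there are processes $\phi^{1*},\phi^{2*}\in L^2_{\mathbb F}(\overline{\mathcal T};\mathbb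 R^n)$, $\Sigma^{1*}\in\mathcal U$, $\Sigma^{2*}\in\mathcal V$ solving the cross-coupled backward stochastic difference equations, for all $k\in\mathcal T$, $$\begin{cases}\phi^{1*}_k=\Theta(T^{1*}_{k+1},\Pi^{2*}_k,\phi^{1*}_{k+1})-\Lambda(T^{1*}_{k+1},\Pi^{2*}_k)^\top\Upsilon^{-1}(T^{1*}_{k+1})\Phi(T^{1*}_{k+1},\Pi^{2*}_k,\phi^{1*}_{k+1}),\\ \Sigma^{1*}_k=-\Upsilon^{-1}(T^{1*}_{k+1})\Phi(T^{1*}_{k+1},\Pi^{2*}_k,\phi^{1*}_{k+1}),\qquad \phi^{1*}_N=g_N,\end{cases}$$ $$\begin{cases}\phi^{2*}_k=\Theta(T^{2*}_{k+1},\Pi^{1*}_k,\phi^{2*}_{k+1})-\Lambda(T^{2*}_{k+1},\Pi^{1*}_k)^\top\Upsilon^{-1}(T^{2*}_{k+1})\Phi(T^{2*}_{k+1},\Pi^{1*}_k,\phi^{2*}_{k+1}),\\ \Sigma^{2*}_k=-\Upsilon^{-1}(T^{2*}_{k+1})\Phi(T^{2*}_{k+1},\Pi^{1*}_k,\phi^{2*}_{k+1}),\qquad \phi^{2*}_N=h_N,\end{cases}$$ where $\Phi,\Theta$ are formed with $\Sigma^1=\Sigma^{1*}$ and $\Sigma^2=\Sigma^{2*}$. Then $(\Pi^{1*},\Sigma^{1*};\Pi^{2*},\Sigma^{2*})\in\mathscr M(\mathcal T)$ is a closed-loop Nash equilibrium (so the closed-loop problem is solvable), and for every $\xi\in\mathbb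 R^n$ the corresponding equilibrium strategy pair has the state feedback representation, for $k\in\mathcal T$, $$u^*_k=\Pi^{1*}_kx^*_k+\Sigma^{1*}_k=-\Upsilon^{-1}(T^{1*}_{k+1})\big[\Lambda(T^{1*}_{k+1},\Pi^{2*}_k)x^*_k+\Phi(T^{1*}_{k+1},\Pi^{2*}_k,\phi^{1*}_{k+1})\big],$$ $$v^*_k=\Pi^{2*}_kx^*_k+\Sigma^{2*}_k=-\Upsilon^{-1}(T^{2*}_{k+1})\big[\Lambda(T^{2*}_{k+1},\Pi^{1*}_k)x^*_k+\Phi(T^{2*}_{k+1},\Pi^{1*}_k,\phi^{2*}_{k+1})\big],$$ where $\mathbf x^*\in L^2_{\mathbb F}(\overline{\mathcal T};\mathbb R^n)$ solves $$x^*_{k+1}=(A_k+B_k\Pi^{1*}_k+C_k\Pi^{2*}_k)x^*_k+B_k\Sigma^{1*}_k+C_k\Sigma^{2*}_k+b_k+\big[(D_k+E_k\Pi^{1*}_k+F_k\Pi^{2*}_k)x^*_k+E_k\Sigma^{1*}_k+F_k\Sigma^{2*}_k+\sigma_k\big]\omega_k,\quad x^*_0=\xi.$$ Moreover, writing $\beta^1_k=(C_k\Sigma^{2*}_k+b_k)+(F_k\Sigma^{2*}_k+\sigma_k)\omega_k$, $\beta^2_k=(B_k\Sigma^{1*}_k+b_k)+(E_k\Sigma^{1*}_k+\sigma_k)\omega_k$, $\Phi^1_k=\Phi(T^{1*}_{k+1},\Pi^{2*}_k,\phi^{1*}_{k+1})$ and $\Phi^2_k=\Phi(T^{2*}_{k+1},\Pi^{1*}_k,\phi^{2*}_{k+1})$,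 the value functions $V_i(0,\xi)=\mathcal J_i(0,\xi;\mathbf u^*,\mathbf v^* )$, $i=1,2$, are $$V_i(0,\xi)=\frac12\mathbb E\Big\{\langle\phi^{i*}_0,\xi\rangle+\langle T^{i*}_0\xi+\phi^{i*}_0,\xi\rangle+\sum_{k=0}^{N-1}\Big[2\langle\phi^{i*}_{k+1},\beta^i_k\rangle-\langle\Phi^i_k,\Upsilon^{-1}(T^{i*}_{k+1})\Phi^i_k\rangle+\langle T^{i*}_{k+1}\beta^i_k,\beta^i_k\rangle\Big]\Big\}.$$
   Context: Setting. $N\ge1$ is an integer, $\mathcal T=\{0,\dots,N-1\}$, $\overline{\mathcal T}=\{0,\dots,N\}$. $(\Omega,\mathcal F,\mathbb F,\mathcal P)$ is a complete filtered probability space carrying scalar random variables $\omega_k$, $\mathcal F_k=\sigma(\omega_0,\dots,\omega_k)$, $\mathcal F_{-1}=\{\emptyset,\Omega\}$, with $\mathbb E[\omega_k\mid\mathcal F_{k-1}]=0$, $\mathbb E[\omega_k^2\mid\mathcal F_{k-1}]=1$. (In)equalities between random variables hold almost surely. $\mathbb S^n$ is the set of symmetric real $n\times n$ matrices and $\mathbb S^n_+$ the positive semidefinite ones. For a Euclidean space $\mathbb H$, $L^2_{\mathbb F}(\mathcal T;\mathbb H)$ (resp. $L^\infty_{\mathbb F}(\mathcal T;\mathbb H)$) is the set of $\mathbb H$-valued processes $(f_k)_{k\in\mathcal T}$ with $f_k$ $\mathcal F_{k-1}$-measurable and $\mathbb E\sum_k\|f_k\|^2<\infty$ (resp. essentially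 bounded); similarly with $\overline{\mathcal T}$. Game. The state equation is $$x_{k+1}=A_kx_k+B_ku_k+C_kv_k+b_k+(D_kx_k+E_ku_k+F_kv_k+\sigma_k)\omega_k,\quad k\in\mathcal T,\qquad x_0=\xi\in\mathbb R^n,$$ with controls $\mathbf u\in\mathcal U:=L^2_{\mathbb F}(\mathcal T;\mathbb R^m)$ (Player 1) and $\mathbf v\in\mathcal V:=L^2_{\mathbb F}(\mathcal T;\mathbb R^l)$ (Player 2). The cost functionals are $$\mathcal J_1(0,\xi;\mathbf u,\mathbf v)=\tfrac12\mathbb E\Big\{\langle G_Nx_N,x_N\rangle+2\langle g_N,x_N\rangle+\sum_{k=0}^{N-1}\big[\langle Q_kx_k,x_k\rangle+2\langle L_k^\top u_k,x_k\rangle+\langle R_ku_k,u_k\rangle+2\langle q_k,x_k\rangle+2\langle\rho_k,u_k\rangle\big]\Big\},$$ $$\mathcal J_2(0,\xi;\mathbf u,\mathbf v)=\tfrac12\mathbb E\Big\{\langle H_Nx_N,x_N\rangle+2\langle h_N,x_N\rangle+\sum_{k=0}^{N-1}\big[\langle P_kx_k,x_k\rangle+2\langle M_k^\top v_k,x_k\rangle+\langle S_kv_k,v_k\rangle+2\langle p_k,x_k\rangle+2\langle\theta_k,v_k\rangle\big]\Big\}.$$ Assumption 1: $A_k,D_k$ ($n\times n$), $B_k,E_k$ ($n\times m$), $C_k,F_k$ ($n\times l$) are uniformly bounded $\mathcal F_{k-1}$-measurable random matrices; $b,\sigma\in L^2_{\mathbb F}(\mathcal T;\mathbb R^n)$.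 Assumption 2: $Q_k,P_k$ (symmetric $n\times n$), $L_k$ ($m\times n$), $M_k$ ($l\times n$), $R_k$ (symmetric $m\times m$), $S_k$ (symmetric $l\times l$) are uniformly bounded $\mathcal F_{k-1}$-measurable random matrices; $G_N,H_N$ are essentially bounded $\mathcal F_{N-1}$-measurable $\mathbb S^n$-valued random matrices; $g_N,h_N$ are square-integrable $\mathcal F_{N-1}$-measurable $\mathbb R^n$-valued; $q,p\in L^2_{\mathbb F}(\mathcal T;\mathbb R^n)$, $\rho\in L^2_{\mathbb F}(\mathcal T;\mathbb R^m)$, $\theta\in L^2_{\mathbb F}(\mathcal T;\mathbb R^l)$. Assumption 3: there is a constant $\delta>0$ such that for all $k\in\mathcal T$: $G_N,H_N\succeq0$, $R_k,S_k\succeq\delta I$, $Q_k-L_k^\top R_k^{-1}L_k\succeq0$, $P_k-M_k^\top S_k^{-1}M_k\succeq0$. Closed-loop strategies. $\mathcal Q^1(\mathcal T)=L^\infty_{\mathbb F}(\mathcal T;\mathbb R^{m\times n})$, $\mathcal Q^2(\mathcal T)=L^\infty_{\mathbb F}(\mathcal T;\mathbb R^{l\times n})$, $\mathscr M^1(\mathcal T)=\mathcal Q^1(\mathcal T)\times\mathcal U$, $\mathscr M^2(\mathcal T)=\mathcal Q^2(\mathcal T)\times\mathcal V$, $\mathscr M(\mathcal T)=\mathscr M^1(\mathcal T)\times\mathscr M^2(\mathcal T)$. For $(\Pi^1,\Sigma^1;\Pi^2,\Sigma^2)\in\mathscr M(\mathcal T)$ and $\xi\in\mathbb R^n$, $X(\Pi^1,\Sigma^1;\Pi^2,\Sigma^2,\xi)$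 is the state trajectory with $u_k=\Pi^1_kx_k+\Sigma^1_k$, $v_k=\Pi^2_kx_k+\Sigma^2_k$, $x_0=\xi$. A quadruple $(\Pi^{1*},\Sigma^{1*};\Pi^{2*},\Sigma^{2*})\in\mathscr M(\mathcal T)$ is a closed-loop Nash equilibrium if for every $\xi\in\mathbb R^n$, with $\mathbf x^*=X(\Pi^{1*},\Sigma^{1*};\Pi^{2*},\Sigma^{2*},\xi)$: $\mathcal J_1(0,\xi;\Pi^{1*}\mathbf x^*+\Sigma^{1*},\Pi^{2*}\mathbf x^*+\Sigma^{2*})\le\mathcal J_1(0,\xi;\Pi^1\mathbf x_1+\Sigma^1,\Pi^{2*}\mathbf x_1+\Sigma^{2*})$ for all $(\Pi^1,\Sigma^1)\in\mathscr M^1(\mathcal T)$, $\mathbf x_1=X(\Pi^1,\Sigma^1;\Pi^{2*},\Sigma^{2*},\xi)$; and $\mathcal J_2(0,\xi;\Pi^{1*}\mathbf x^*+\Sigma^{1*},\Pi^{2*}\mathbf x^*+\Sigma^{2*})\le\mathcal J_2(0,\xi;\Pi^{1*}\mathbf x_2+\Sigma^{1*},\Pi^2\mathbf x_2+\Sigma^2)$ for all $(\Pi^2,\Sigma^2)\in\mathscr M^2(\mathcal T)$, $\mathbf x_2=X(\Pi^{1*},\Sigma^{1*};\Pi^2,\Sigma^2,\xi)$. Notation for the Riccati equations. For $i=1,2$ and $j=0,1,2$ write $\tau^{i,j}_k=\mathbb E[T^i_{k+1}\omega_k^j\mid\mathcal F_{k-1}]$, and for $j=0,1$ write $\varphi^{i,j}_k=\mathbb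 E[\phi^i_{k+1}\omega_k^j\mid\mathcal F_{k-1}]$. Let $\hat A_k=A_k+C_k\Pi^2_k$, $\hat D_k=D_k+F_k\Pi^2_k$, $\check A_k=A_k+B_k\Pi^1_k$, $\check D_k=D_k+E_k\Pi^1_k$. The symbols have different meaning according to the player superscript of their arguments. Player 1: $\Upsilon(T^1_{k+1})=R_k+B_k^\top\tau^{1,0}_kB_k+B_k^\top\tau^{1,1}_kE_k+E_k^\top\tau^{1,1}_kB_k+E_k^\top\tau^{1,2}_kE_k$, $\Lambda(T^1_{k+1},\Pi^2_k)=L_k+B_k^\top\tau^{1,0}_k\hat A_k+E_k^\top\tau^{1,1}_k\hat A_k+B_k^\top\tau^{1,1}_k\hat D_k+E_k^\top\tau^{1,2}_k\hat D_k$, $\Delta(T^1_{k+1},\Pi^2_k)=Q_k+\hat A_k^\top\tau^{1,0}_k\hat A_k+\hat A_k^\top\tau^{1,1}_k\hat D_k+\hat D_k^\top\tau^{1,1}_k\hat A_k+\hat D_k^\top\tau^{1,2}_k\hat D_k$, $\Phi(T^1_{k+1},\Pi^2_k,\phi^1_{k+1})=\rho_k+B_k^\top[\tau^{1,0}_k(C_k\Sigma^2_k+b_k)+\tau^{1,1}_k(F_k\Sigma^2_k+\sigma_k)+\varphi^{1,0}_k]+E_k^\top[\tau^{1,1}_k(C_k\Sigma^2_k+b_k)+\tau^{1,2}_k(F_k\Sigma^2_k+\sigma_k)+\varphi^{1,1}_k]$, $\Theta(T^1_{k+1},\Pi^2_k,\phi^1_{k+1})=q_k+\hat A_k^\top[\tau^{1,0}_k(C_k\Sigma^2_k+b_k)+\tau^{1,1}_k(F_k\Sigma^2_k+\sigma_k)+\varphi^{1,0}_k]+\hat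 D_k^\top[\tau^{1,1}_k(C_k\Sigma^2_k+b_k)+\tau^{1,2}_k(F_k\Sigma^2_k+\sigma_k)+\varphi^{1,1}_k]$. Player 2: $\Upsilon(T^2_{k+1})=S_k+C_k^\top\tau^{2,0}_kC_k+C_k^\top\tau^{2,1}_kF_k+F_k^\top\tau^{2,1}_kC_k+F_k^\top\tau^{2,2}_kF_k$, $\Lambda(T^2_{k+1},\Pi^1_k)=M_k+C_k^\top\tau^{2,0}_k\check A_k+C_k^\top\tau^{2,1}_k\check D_k+F_k^\top\tau^{2,1}_k\check A_k+F_k^\top\tau^{2,2}_k\check D_k$, $\Delta(T^2_{k+1},\Pi^1_k)=P_k+\check A_k^\top\tau^{2,0}_k\check A_k+\check A_k^\top\tau^{2,1}_k\check D_k+\check D_k^\top\tau^{2,1}_k\check A_k+\check D_k^\top\tau^{2,2}_k\check D_k$, $\Phi(T^2_{k+1},\Pi^1_k,\phi^2_{k+1})=\theta_k+C_k^\top[\tau^{2,0}_k(B_k\Sigma^1_k+b_k)+\tau^{2,1}_k(E_k\Sigma^1_k+\sigma_k)+\varphi^{2,0}_k]+F_k^\top[\tau^{2,1}_k(B_k\Sigma^1_k+b_k)+\tau^{2,2}_k(E_k\Sigma^1_k+\sigma_k)+\varphi^{2,1}_k]$, $\Theta(T^2_{k+1},\Pi^1_k,\phi^2_{k+1})=p_k+\check A_k^\top[\tau^{2,0}_k(B_k\Sigma^1_k+b_k)+\tau^{2,1}_k(E_k\Sigma^1_k+\sigma_k)+\varphi^{2,0}_k]+\check D_k^\top[\tau^{2,1}_k(B_k\Sigma^1_k+b_k)+\tau^{2,2}_k(E_k\Sigma^1_k+\sigma_k)+\varphi^{2,1}_k]$.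 $\Upsilon^{-1}(\cdot)$ denotes the inverse matrix of $\Upsilon(\cdot)$. *)

(* Defs.v *)
From HB Require Import structures.
From mathcomp Require Import all_boot all_order all_algebra.
From mathcomp Require Import all_classical all_reals all_analysis.

Set Implicit Arguments.
Unset Strict Implicit.
Unset Printing Implicit Defensive.

Import Order.TTheory GRing.Theory Num.Theory.
Import numFieldNormedType.Exports.

Local Open Scope classical_set_scope.
Local Open Scope ring_scope.

Definition dotv (R : realType) (n : nat) (x y : 'cV[R]_n) : R :=
  (x^T *m y) ord0 ord0.

(* Euclidean (Frobenius) norm on matrices; the matrix norm of the library is
   the max norm. *)
Definition enorm (R : realType) (p q : nat) (M : 'M[R]_(p, q)) : R :=
  Num.sqrt (\sum_i \sum_j M i j ^+ 2).

Definition symmx (R : realType) (n : nat) (M : 'M[R]_n) : Prop := M^T = M.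

Definition psdmx (R : realType) (n : nat) (M : 'M[R]_n) : Prop :=
  symmx M /\ forall x : 'cV[R]_n, 0 <= dotv (M *m x) x.

Definition pdmx (R : realType) (n : nat) (M : 'M[R]_n) : Prop :=
  symmx M /\ forall x : 'cV[R]_n, x != 0 -> 0 < dotv (M *m x) x.

(* Time-indexed coefficients are total functions on nat; only the indices
   k < N are ever constrained or used. *)
Record lq_game (R : realType) (Omega : Type) (n m l : nat) := LQGame {
  noise : nat -> Omega -> R;
  cA : nat -> Omega -> 'M[R]_n;
  cB : nat -> Omega -> 'M[R]_(n, m);
  cC : nat -> Omega -> 'M[R]_(n, l);
  cb : nat -> Omega -> 'cV[R]_n;
  cD : nat -> Omega -> 'M[R]_n;
  cE : nat -> Omega -> 'M[R]_(n, m);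
  cF : nat -> Omega -> 'M[R]_(n, l);
  csigma : nat -> Omega -> 'cV[R]_n;
  cQ : nat -> Omega -> 'M[R]_n;
  cL : nat -> Omega -> 'M[R]_(m, n);
  cR : nat -> Omega -> 'M[R]_m;
  cq : nat -> Omega -> 'cV[R]_n;
  crho : nat -> Omega -> 'cV[R]_m;
  cGN : Omega -> 'M[R]_n;
  cgN : Omega -> 'cV[R]_n;
  cP : nat -> Omega -> 'M[R]_n;
  cM : nat -> Omega -> 'M[R]_(l, n);
  cS : nat -> Omega -> 'M[R]_l;
  cp : nat -> Omega -> 'cV[R]_n;
  ctheta : nat -> Omega -> 'cV[R]_l;
  cHN : Omega -> 'M[R]_n;
  chN : Omega -> 'cV[R]_n
}.

Section Measurability.
Context (R : realType) (d : measure_display) (Omega : measurableType d).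
Variable Pr : probability Omega R.

Definition sub_measurable (G : set (set Omega)) (X : Omega -> R) : Prop :=
  forall B : set R, measurable B -> G (X @^-1` B).

Definition sub_measurable_mx (G : set (set Omega)) (p q : nat)
    (X : Omega -> 'M[R]_(p, q)) : Prop :=
  forall i j, sub_measurable G (fun w => X w i j).

Definition is_cond_exp (G : set (set Omega)) (X Y : Omega -> R) : Prop :=
  [/\ Pr.-integrable setT (EFin \o X),
      sub_measurable G Y,
      Pr.-integrable setT (EFin \o Y) &
      forall A, G A -> (\int[Pr]_(w in A) (Y w)%:E = \int[Pr]_(w in A) (X w)%:E)%E].

(* A version of E[X | G], chosen by classical choice; meaningful for integrable
   X and a sub-sigma-algebra G. *)
Definition cond_exp (G : set (set Omega)) (X : Omega -> R) : Omega -> R :=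
  xget (cst 0) [set Y | is_cond_exp G X Y].

Definition cond_exp_mx (G : set (set Omega)) (p q : nat)
    (X : Omega -> 'M[R]_(p, q)) (w : Omega) : 'M[R]_(p, q) :=
  \matrix_(i, j) cond_exp G (fun w' => X w' i j) w.

End Measurability.

Section Game.
Context (R : realType) (d : measure_display) (Omega : measurableType d).
Variable Pr : probability Omega R.
Variables (n m l : nat) (g : lq_game R Omega n m l) (N : nat).

(* filt k is F_{k-1} = sigma(omega_0, ..., omega_{k-1}); filt 0 is the trivial
   sigma-algebra F_{-1}. *)
Definition filt (k : nat) : set (set Omega) :=
  <<s \bigcup_(i in [set i | (i < k)%N])
        preimage_set_system setT (noise g i) measurable >>.

Definition noise_assumption : Prop :=
  forall k, (k < N)%N ->
    [/\ measurable_fun setT (noise g k),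
        is_cond_exp Pr (filt k) (noise g k) (cst 0) &
        is_cond_exp Pr (filt k) (fun w => noise g k w ^+ 2) (cst 1)].

(* The time set of a process is {0, ..., K - 1}: K = N for T and K = N.+1 for
   its closure. *)
Definition L2F (K p : nat) (f : nat -> Omega -> 'cV[R]_p) : Prop :=
  (forall k, (k < K)%N -> sub_measurable_mx (filt k) (f k)) /\
  ('E_Pr[(fun w => \sum_(k < K) enorm (f k w) ^+ 2)%R] < +oo)%E.

Definition LinfF (K p q : nat) (f : nat -> Omega -> 'M[R]_(p, q)) : Prop :=
  (forall k, (k < K)%N -> sub_measurable_mx (filt k) (f k)) /\
  (exists c : R, forall k, (k < K)%N -> \forall w \ae Pr, enorm (f k w) <= c).

Definition L2_terminal (p : nat) (f : Omega -> 'cV[R]_p) : Prop :=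
  sub_measurable_mx (filt N) f /\ ('E_Pr[(fun w => enorm (f w) ^+ 2)%R] < +oo)%E.

Definition Linf_terminal (p q : nat) (f : Omega -> 'M[R]_(p, q)) : Prop :=
  sub_measurable_mx (filt N) f /\
  (exists c : R, \forall w \ae Pr, enorm (f w) <= c).

Definition assumption1 : Prop :=
  [/\ [/\ LinfF N (cA g), LinfF N (cB g) & LinfF N (cC g)],
      [/\ LinfF N (cD g), LinfF N (cE g) & LinfF N (cF g)],
      L2F N (cb g) & L2F N (csigma g)].

Definition assumption2 : Prop :=
  [/\ [/\ LinfF N (cQ g), LinfF N (cL g) & LinfF N (cR g)],
      [/\ LinfF N (cP g), LinfF N (cM g) & LinfF N (cS g)],
      (forall k, (k < N)%N -> \forall w \ae Pr,
         [/\ symmx (cQ g k w), symmx (cR g k w),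
             symmx (cP g k w) & symmx (cS g k w)]),
      [/\ Linf_terminal (cGN g), Linf_terminal (cHN g),
          L2_terminal (cgN g), L2_terminal (chN g) &
          \forall w \ae Pr, symmx (cGN g w) /\ symmx (cHN g w)] &
      [/\ L2F N (cq g), L2F N (crho g), L2F N (cp g) & L2F N (ctheta g)]].

Definition assumption3 : Prop :=
  exists2 delta : R, 0 < delta &
    (\forall w \ae Pr, psdmx (cGN g w) /\ psdmx (cHN g w)) /\
    (forall k, (k < N)%N -> \forall w \ae Pr,
      [/\ psdmx (cR g k w - delta%:M),
          psdmx (cS g k w - delta%:M),
          psdmx (cQ g k w - (cL g k w)^T *m invmx (cR g k w) *m cL g k w) &
          psdmx (cP g k w - (cM g k w)^T *m invmx (cS g k w) *m cM g k w)]).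

Fixpoint state (xi : 'cV[R]_n) (u : nat -> Omega -> 'cV[R]_m)
    (v : nat -> Omega -> 'cV[R]_l) (k : nat) (w : Omega) : 'cV[R]_n :=
  if k is k'.+1 then
    let x := state xi u v k' w in
    cA g k' w *m x + cB g k' w *m u k' w + cC g k' w *m v k' w + cb g k' w +
    noise g k' w *: (cD g k' w *m x + cE g k' w *m u k' w +
                     cF g k' w *m v k' w + csigma g k' w)
  else xi.

Definition J1 (xi : 'cV[R]_n) (u : nat -> Omega -> 'cV[R]_m)
    (v : nat -> Omega -> 'cV[R]_l) : \bar R :=
  let x := state xi u v in
  ((2^-1)%:E * 'E_Pr[(fun w =>
     dotv (cGN g w *m x N w) (x N w) + 2 * dotv (cgN g w) (x N w) +
     \sum_(k < N) (dotv (cQ g k w *m x k w) (x k w) +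
                   2 * dotv ((cL g k w)^T *m u k w) (x k w) +
                   dotv (cR g k w *m u k w) (u k w) +
                   2 * dotv (cq g k w) (x k w) +
                   2 * dotv (crho g k w) (u k w)))%R])%E.

Definition J2 (xi : 'cV[R]_n) (u : nat -> Omega -> 'cV[R]_m)
    (v : nat -> Omega -> 'cV[R]_l) : \bar R :=
  let x := state xi u v in
  ((2^-1)%:E * 'E_Pr[(fun w =>
     dotv (cHN g w *m x N w) (x N w) + 2 * dotv (chN g w) (x N w) +
     \sum_(k < N) (dotv (cP g k w *m x k w) (x k w) +
                   2 * dotv ((cM g k w)^T *m v k w) (x k w) +
                   dotv (cS g k w *m v k w) (v k w) +
                   2 * dotv (cp g k w) (x k w) +
                   2 * dotv (ctheta g k w) (v k w)))%R])%E.

Definition feedback (p : nat) (Pi : nat -> Omega -> 'M[R]_(p, n))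
    (Sig : nat -> Omega -> 'cV[R]_p) (x : nat -> Omega -> 'cV[R]_n)
    (k : nat) (w : Omega) : 'cV[R]_p :=
  Pi k w *m x k w + Sig k w.

(* The trajectory X(Pi1, Sig1; Pi2, Sig2, xi). *)
Fixpoint cl_state (Pi1 : nat -> Omega -> 'M[R]_(m, n))
    (Sig1 : nat -> Omega -> 'cV[R]_m) (Pi2 : nat -> Omega -> 'M[R]_(l, n))
    (Sig2 : nat -> Omega -> 'cV[R]_l) (xi : 'cV[R]_n)
    (k : nat) (w : Omega) : 'cV[R]_n :=
  if k is k'.+1 then
    let x := cl_state Pi1 Sig1 Pi2 Sig2 xi k' w in
    let u := Pi1 k' w *m x + Sig1 k' w in
    let v := Pi2 k' w *m x + Sig2 k' w in
    cA g k' w *m x + cB g k' w *m u + cC g k' w *m v + cb g k' w +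
    noise g k' w *: (cD g k' w *m x + cE g k' w *m u +
                     cF g k' w *m v + csigma g k' w)
  else xi.

Definition strategy (p : nat) (Pi : nat -> Omega -> 'M[R]_(p, n))
    (Sig : nat -> Omega -> 'cV[R]_p) : Prop :=
  LinfF N Pi /\ L2F N Sig.

Definition closed_loop_nash (Pi1 : nat -> Omega -> 'M[R]_(m, n))
    (Sig1 : nat -> Omega -> 'cV[R]_m) (Pi2 : nat -> Omega -> 'M[R]_(l, n))
    (Sig2 : nat -> Omega -> 'cV[R]_l) : Prop :=
  [/\ strategy Pi1 Sig1, strategy Pi2 Sig2 &
   forall xi : 'cV[R]_n,
    let x := cl_state Pi1 Sig1 Pi2 Sig2 xi in
    let u := feedback Pi1 Sig1 x in
    let v := feedback Pi2 Sig2 x in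
    (forall Pi1' Sig1', strategy Pi1' Sig1' ->
      let x1 := cl_state Pi1' Sig1' Pi2 Sig2 xi in
      (J1 xi u v <= J1 xi (feedback Pi1' Sig1' x1) (feedback Pi2 Sig2 x1))%E) /\
    (forall Pi2' Sig2', strategy Pi2' Sig2' ->
      let x2 := cl_state Pi1 Sig1 Pi2' Sig2' xi in
      (J2 xi u v <= J2 xi (feedback Pi1 Sig1 x2) (feedback Pi2' Sig2' x2))%E)].

Definition closed_loop_solvable : Prop :=
  exists Pi1 Sig1 Pi2 Sig2, closed_loop_nash Pi1 Sig1 Pi2 Sig2.

(* E[Y_{k+1} omega_k^j | F_{k-1}]: tau^{i,j}_k for Y = T^i and
   varphi^{i,j}_k for Y = phi^i. *)
Definition cmoment (j p q : nat) (Y : nat -> Omega -> 'M[R]_(p, q))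
    (k : nat) : Omega -> 'M[R]_(p, q) :=
  cond_exp_mx Pr (filt k) (fun w => noise g k w ^+ j *: Y k.+1 w).

(* Below, T and phi are whole processes, of which only the values at k.+1
   enter; Upsilon1, Lambda1, ... are the symbols carrying player 1's arguments
   and Upsilon2, Lambda2, ... those carrying player 2's. *)

Definition Ahat (Pi2 : nat -> Omega -> 'M[R]_(l, n)) k w : 'M[R]_n :=
  cA g k w + cC g k w *m Pi2 k w.

Definition Dhat (Pi2 : nat -> Omega -> 'M[R]_(l, n)) k w : 'M[R]_n :=
  cD g k w + cF g k w *m Pi2 k w.

Definition Acheck (Pi1 : nat -> Omega -> 'M[R]_(m, n)) k w : 'M[R]_n :=
  cA g k w + cB g k w *m Pi1 k w.

Definition Dcheck (Pi1 : nat -> Omega -> 'M[R]_(m, n)) k w : 'M[R]_n :=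
  cD g k w + cE g k w *m Pi1 k w.

Definition Upsilon1 (T : nat -> Omega -> 'M[R]_n) k w : 'M[R]_m :=
  let B := cB g k w in let E := cE g k w in
  let t0 := cmoment 0 T k w in
  let t1 := cmoment 1 T k w in
  let t2 := cmoment 2 T k w in
  cR g k w + B^T *m t0 *m B + B^T *m t1 *m E + E^T *m t1 *m B + E^T *m t2 *m E.

Definition Lambda1 (T : nat -> Omega -> 'M[R]_n)
    (Pi2 : nat -> Omega -> 'M[R]_(l, n)) k w : 'M[R]_(m, n) :=
  let B := cB g k w in let E := cE g k w in
  let A := Ahat Pi2 k w in let D := Dhat Pi2 k w in
  let t0 := cmoment 0 T k w in
  let t1 := cmoment 1 T k w in
  let t2 := cmoment 2 T k w in
  cL g k w + B^T *m t0 *m A + E^T *m t1 *m A + B^T *m t1 *m D + E^T *m t2 *m D.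

Definition Delta1 (T : nat -> Omega -> 'M[R]_n)
    (Pi2 : nat -> Omega -> 'M[R]_(l, n)) k w : 'M[R]_n :=
  let A := Ahat Pi2 k w in let D := Dhat Pi2 k w in
  let t0 := cmoment 0 T k w in
  let t1 := cmoment 1 T k w in
  let t2 := cmoment 2 T k w in
  cQ g k w + A^T *m t0 *m A + A^T *m t1 *m D + D^T *m t1 *m A + D^T *m t2 *m D.

(* Phi does not involve Pi2. *)
Definition Phi1 (T : nat -> Omega -> 'M[R]_n)
    (Sig2 : nat -> Omega -> 'cV[R]_l) (phi : nat -> Omega -> 'cV[R]_n)
    k w : 'cV[R]_m :=
  let a := cC g k w *m Sig2 k w + cb g k w in
  let s := cF g k w *m Sig2 k w + csigma g k w in
  let t0 := cmoment 0 T k w in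
  let t1 := cmoment 1 T k w in
  let t2 := cmoment 2 T k w in
  crho g k w +
  (cB g k w)^T *m (t0 *m a + t1 *m s + cmoment 0 phi k w) +
  (cE g k w)^T *m (t1 *m a + t2 *m s + cmoment 1 phi k w).

Definition Theta1 (T : nat -> Omega -> 'M[R]_n)
    (Pi2 : nat -> Omega -> 'M[R]_(l, n)) (Sig2 : nat -> Omega -> 'cV[R]_l)
    (phi : nat -> Omega -> 'cV[R]_n) k w : 'cV[R]_n :=
  let a := cC g k w *m Sig2 k w + cb g k w in
  let s := cF g k w *m Sig2 k w + csigma g k w in
  let t0 := cmoment 0 T k w in
  let t1 := cmoment 1 T k w in
  let t2 := cmoment 2 T k w in
  cq g k w +
  (Ahat Pi2 k w)^T *m (t0 *m a + t1 *m s + cmoment 0 phi k w) +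
  (Dhat Pi2 k w)^T *m (t1 *m a + t2 *m s + cmoment 1 phi k w).

Definition Upsilon2 (T : nat -> Omega -> 'M[R]_n) k w : 'M[R]_l :=
  let C := cC g k w in let F := cF g k w in
  let t0 := cmoment 0 T k w in
  let t1 := cmoment 1 T k w in
  let t2 := cmoment 2 T k w in
  cS g k w + C^T *m t0 *m C + C^T *m t1 *m F + F^T *m t1 *m C + F^T *m t2 *m F.

Definition Lambda2 (T : nat -> Omega -> 'M[R]_n)
    (Pi1 : nat -> Omega -> 'M[R]_(m, n)) k w : 'M[R]_(l, n) :=
  let C := cC g k w in let F := cF g k w in
  let A := Acheck Pi1 k w in let D := Dcheck Pi1 k w in
  let t0 := cmoment 0 T k w in
  let t1 := cmoment 1 T k w in
  let t2 := cmoment 2 T k w in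
  cM g k w + C^T *m t0 *m A + C^T *m t1 *m D + F^T *m t1 *m A + F^T *m t2 *m D.

Definition Delta2 (T : nat -> Omega -> 'M[R]_n)
    (Pi1 : nat -> Omega -> 'M[R]_(m, n)) k w : 'M[R]_n :=
  let A := Acheck Pi1 k w in let D := Dcheck Pi1 k w in
  let t0 := cmoment 0 T k w in
  let t1 := cmoment 1 T k w in
  let t2 := cmoment 2 T k w in
  cP g k w + A^T *m t0 *m A + A^T *m t1 *m D + D^T *m t1 *m A + D^T *m t2 *m D.

Definition Phi2 (T : nat -> Omega -> 'M[R]_n)
    (Sig1 : nat -> Omega -> 'cV[R]_m) (phi : nat -> Omega -> 'cV[R]_n)
    k w : 'cV[R]_l :=
  let a := cB g k w *m Sig1 k w + cb g k w in
  let s := cE g k w *m Sig1 k w + csigma g k w in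
  let t0 := cmoment 0 T k w in
  let t1 := cmoment 1 T k w in
  let t2 := cmoment 2 T k w in
  ctheta g k w +
  (cC g k w)^T *m (t0 *m a + t1 *m s + cmoment 0 phi k w) +
  (cF g k w)^T *m (t1 *m a + t2 *m s + cmoment 1 phi k w).

Definition Theta2 (T : nat -> Omega -> 'M[R]_n)
    (Pi1 : nat -> Omega -> 'M[R]_(m, n)) (Sig1 : nat -> Omega -> 'cV[R]_m)
    (phi : nat -> Omega -> 'cV[R]_n) k w : 'cV[R]_n :=
  let a := cB g k w *m Sig1 k w + cb g k w in
  let s := cE g k w *m Sig1 k w + csigma g k w in
  let t0 := cmoment 0 T k w in
  let t1 := cmoment 1 T k w in
  let t2 := cmoment 2 T k w in
  cp g k w +
  (Acheck Pi1 k w)^T *m (t0 *m a + t1 *m s + cmoment 0 phi k w) +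
  (Dcheck Pi1 k w)^T *m (t1 *m a + t2 *m s + cmoment 1 phi k w).

Definition LinfF_psd (T : nat -> Omega -> 'M[R]_n) : Prop :=
  LinfF N.+1 T /\ forall k, (k <= N)%N -> \forall w \ae Pr, psdmx (T k w).

Definition riccati1 (T1 : nat -> Omega -> 'M[R]_n)
    (Pi1 : nat -> Omega -> 'M[R]_(m, n))
    (Pi2 : nat -> Omega -> 'M[R]_(l, n)) : Prop :=
  (forall k, (k < N)%N -> \forall w \ae Pr,
    T1 k w = Delta1 T1 Pi2 k w
             - (Lambda1 T1 Pi2 k w)^T *m invmx (Upsilon1 T1 k w)
               *m Lambda1 T1 Pi2 k w /\
    Pi1 k w = - (invmx (Upsilon1 T1 k w) *m Lambda1 T1 Pi2 k w)) /\
  (\forall w \ae Pr, T1 N w = cGN g w).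

Definition riccati2 (T2 : nat -> Omega -> 'M[R]_n)
    (Pi1 : nat -> Omega -> 'M[R]_(m, n))
    (Pi2 : nat -> Omega -> 'M[R]_(l, n)) : Prop :=
  (forall k, (k < N)%N -> \forall w \ae Pr,
    T2 k w = Delta2 T2 Pi1 k w
             - (Lambda2 T2 Pi1 k w)^T *m invmx (Upsilon2 T2 k w)
               *m Lambda2 T2 Pi1 k w /\
    Pi2 k w = - (invmx (Upsilon2 T2 k w) *m Lambda2 T2 Pi1 k w)) /\
  (\forall w \ae Pr, T2 N w = cHN g w).

Definition strongly_regular (T1 T2 : nat -> Omega -> 'M[R]_n) : Prop :=
  exists2 delta : R, 0 < delta &
    forall k, (k < N)%N -> \forall w \ae Pr,
      pdmx (Upsilon1 T1 k w - delta%:M) /\ pdmx (Upsilon2 T2 k w - delta%:M).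

Definition bsde1 (T1 : nat -> Omega -> 'M[R]_n)
    (Pi2 : nat -> Omega -> 'M[R]_(l, n)) (phi1 : nat -> Omega -> 'cV[R]_n)
    (Sig1 : nat -> Omega -> 'cV[R]_m) (Sig2 : nat -> Omega -> 'cV[R]_l) : Prop :=
  (forall k, (k < N)%N -> \forall w \ae Pr,
    phi1 k w = Theta1 T1 Pi2 Sig2 phi1 k w
               - (Lambda1 T1 Pi2 k w)^T *m invmx (Upsilon1 T1 k w)
                 *m Phi1 T1 Sig2 phi1 k w /\
    Sig1 k w = - (invmx (Upsilon1 T1 k w) *m Phi1 T1 Sig2 phi1 k w)) /\
  (\forall w \ae Pr, phi1 N w = cgN g w).

Definition bsde2 (T2 : nat -> Omega -> 'M[R]_n)
    (Pi1 : nat -> Omega -> 'M[R]_(m, n)) (phi2 : nat -> Omega -> 'cV[R]_n)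
    (Sig1 : nat -> Omega -> 'cV[R]_m) (Sig2 : nat -> Omega -> 'cV[R]_l) : Prop :=
  (forall k, (k < N)%N -> \forall w \ae Pr,
    phi2 k w = Theta2 T2 Pi1 Sig1 phi2 k w
               - (Lambda2 T2 Pi1 k w)^T *m invmx (Upsilon2 T2 k w)
                 *m Phi2 T2 Sig1 phi2 k w /\
    Sig2 k w = - (invmx (Upsilon2 T2 k w) *m Phi2 T2 Sig1 phi2 k w)) /\
  (\forall w \ae Pr, phi2 N w = chN g w).

Definition beta1 (Sig2 : nat -> Omega -> 'cV[R]_l) k w : 'cV[R]_n :=
  (cC g k w *m Sig2 k w + cb g k w)
  + noise g k w *: (cF g k w *m Sig2 k w + csigma g k w).

Definition beta2 (Sig1 : nat -> Omega -> 'cV[R]_m) k w : 'cV[R]_n :=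
  (cB g k w *m Sig1 k w + cb g k w)
  + noise g k w *: (cE g k w *m Sig1 k w + csigma g k w).

End Game.

(* Main.v *)
Require Import Defs.
From HB Require Import structures.
From mathcomp Require Import all_boot all_order all_algebra.
From mathcomp Require Import all_classical all_reals all_analysis.
From mathcomp Require Import measurable_realfun ring lra.

Set Implicit Arguments.
Unset Strict Implicit.
Unset Printing Implicit Defensive.

Import Order.TTheory GRing.Theory Num.Theory.
Import numFieldNormedType.Exports.

Local Open Scope classical_set_scope.
Local Open Scope ring_scope.

(* When player 2 keeps the feedback (Pi2, Sig2), player 1 faces an ordinary
   linear-quadratic control problem with state coefficients A + C Pi2, D + F Pi2
   and inhomogeneous term beta1. Put V_k(x) = <T_k x, x> + 2 <phi_k, x>. Since x_k
   and u_k are F_{k-1}-measurable, they can be pulled out of the conditional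
   expectation of V_{k+1}(x_{k+1}), which turns T_{k+1} and phi_{k+1} into their
   conditional moments; completing the square with the Riccati and backward
   equations then gives, in mean,
     stage_k + V_{k+1}(x_{k+1}) =
       V_k(x_k) + <Upsilon_k d_k, d_k> + V_{k+1}(beta_k) - <Phi_k, Upsilon_k^-1 Phi_k>
   with d_k = u_k + Upsilon_k^-1 (Lambda_k x_k + Phi_k). Summing over k, the cost
   is a constant plus the nonnegative mean of the terms in d_k, which vanish
   along the proposed feedback. Player 2 is player 1 of the game with
   exchanged roles. *)

(** The obstacle is integrability. Controls are only square-integrable, so the factors pulled out of
    a conditional expectation are unbounded, and [cond_exp] by itself provides integrable moments,
    neither bounded nor square-integrable ones. Hence no direct bound makes <Upsilon d, d> or <Phi,
    Upsilon^-1 Phi> integrable, and a mean cannot be split along them for free. Three devices answer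
    this. The pull-out rule assumes that Z X is integrable and deduces that Z E[X | F] is. The sum
    of the two doubtful terms is identified almost surely with a difference of integrable functions;
    evaluating it at state 0 and control [Sig], where d = 0, isolates the term in Phi, and the term
    in d follows for every control. Completeness of [Pr] carries measurability along almost sure
    equalities, so that the measurability of Upsilon^-1 is never examined. All identities are kept
    in mean rather than conditionally on F_{k-1}, which is enough for the sum over k to
    telescope. *)

(** * Integrable functions, equality in mean and square-integrability *)

Section SameMean.
Context (R : realType) (d : measure_display) (Omega : measurableType d).
Variable Pr : probability Omega R.
Implicit Types f g h b : Omega -> R.

Definition rintegrable f : Prop := Pr.-integrable setT (EFin \o f).

Lemma rintegrable_measurable f : rintegrable f -> measurable_fun setT f.
Proof. by move=> /measurable_int/measurable_EFinP. Qed.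

Lemma rintegrable_lty f : measurable_fun setT f ->
  (\int[Pr]_w `|f w|%:E < +oo)%E -> rintegrable f.
Proof. by move=> mf foo; apply/integrableP; split; first exact/measurable_EFinP. Qed.

Lemma rintegrable_ae_le f g : measurable_fun setT f -> rintegrable g ->
  (\forall w \ae Pr, `|f w| <= g w) -> rintegrable f.
Proof.
move=> mf /integrableP[/measurable_EFinP mg goo] fg.
apply: rintegrable_lty => //; apply: le_lt_trans goo.
apply: ae_ge0_le_integral => //.
- exact/measurable_EFinP/measurableT_comp.
- exact/measurableT_comp/measurable_EFinP.
- by apply: filterS fg => w fgw _ /=; rewrite lee_fin (le_trans fgw)// ler_norm.
Qed.

Lemma rintegrable_cst c : rintegrable (cst c).
Proof. exact: finite_measure_integrable_cst. Qed.

Lemma rintegrableD f g : rintegrable f -> rintegrable g ->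
  rintegrable (fun w => f w + g w).
Proof. by move=> f1 g1; apply: eq_integrable (integrableD _ f1 g1). Qed.

Lemma rintegrableB f g : rintegrable f -> rintegrable g ->
  rintegrable (fun w => f w - g w).
Proof. by move=> f1 g1; apply: eq_integrable (integrableB _ f1 g1). Qed.

Lemma rintegrableZ c f : rintegrable f -> rintegrable (fun w => c * f w).
Proof. by move=> f1; apply: eq_integrable (integrableZl _ c f1). Qed.

Lemma rintegrable_sum (I : Type) (s : seq I) (f : I -> Omega -> R) :
  (forall i, rintegrable (f i)) -> rintegrable (fun w => \sum_(i <- s) f i w).
Proof.
move=> fi; elim: s => [|i s IH].
  by under eq_fun do rewrite big_nil; exact: rintegrable_cst.
by under eq_fun do rewrite big_cons; exact: rintegrableD.
Qed.

Lemma rintegrable_norm f : rintegrable f -> rintegrable (fun w => `|f w|).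
Proof. by move=> /integrable_norm. Qed.

Lemma rintegrable_ae_eq f g : measurable_fun setT g ->
  (\forall w \ae Pr, f w = g w) -> rintegrable f -> rintegrable g.
Proof.
move=> mg fg /rintegrable_norm f1; apply: rintegrable_ae_le f1 _ => //.
by apply: filterS fg => w ->.
Qed.

Lemma Rintegral_ae_eq f g : measurable_fun setT f -> measurable_fun setT g ->
  (\forall w \ae Pr, f w = g w) -> \int[Pr]_w f w = \int[Pr]_w g w.
Proof.
move=> mf mg fg; congr fine; apply: ae_eq_integral => //.
- exact/measurable_EFinP.
- exact/measurable_EFinP.
- by apply: filterS fg => w -> _.
Qed.

Lemma Rintegral_ae_ge0 f : measurable_fun setT f ->
  (\forall w \ae Pr, 0 <= f w) -> 0 <= \int[Pr]_w f w.
Proof.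
move=> mf f0; rewrite (Rintegral_ae_eq (g := fun w => `|f w|))//.
- by apply: Rintegral_ge0 => w _.
- exact: measurableT_comp.
- by apply: filterS f0 => w /ger0_norm.
Qed.

(** Completeness supplies the measurability of [g]. This is what allows formulas containing [invmx]
    to be handled through an almost sure equality alone. *)
Lemma rintegrable_complete f g : measure_is_complete Pr ->
  (\forall w \ae Pr, f w = g w) -> rintegrable f -> rintegrable g.
Proof.
move=> cP fg fi; apply: (rintegrable_ae_eq _ fg fi); apply/measurable_EFinP.
apply: (ae_measurable_fun cP) (measurable_int _ fi).
by apply: filterS fg => w /= -> _.
Qed.

(** Integrability is bundled with the equality because the real-valued integral is additive only on
    integrable functions; the bundle is then stable under sums, differences and scaling. *)
Definition same_mean f g : Prop :=
  [/\ rintegrable f, rintegrable g & \int[Pr]_w f w = \int[Pr]_w g w].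

Lemma same_mean_refl f : rintegrable f -> same_mean f f.
Proof. by []. Qed.

Lemma same_mean_sym f g : same_mean f g -> same_mean g f.
Proof. by case. Qed.

Lemma same_mean_trans g f h : same_mean f g -> same_mean g h -> same_mean f h.
Proof. by move=> [? ? e] [? ? e']; split=> //; rewrite e. Qed.

Lemma same_meanD f f' g g' : same_mean f f' -> same_mean g g' ->
  same_mean (fun w => f w + g w) (fun w => f' w + g' w).
Proof.
move=> [? ? e] [? ? e']; split; [exact: rintegrableD..|].
by rewrite !RintegralD// e e'.
Qed.

Lemma same_meanZ c f f' : same_mean f f' ->
  same_mean (fun w => c * f w) (fun w => c * f' w).
Proof.
move=> [? ? e]; split; [exact: rintegrableZ..|].
by rewrite !RintegralZl// e.
Qed.

Lemma same_meanB f f' g g' : same_mean f f' -> same_mean g g' ->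
  same_mean (fun w => f w - g w) (fun w => f' w - g' w).
Proof.
move=> [? ? e] [? ? e']; split; [exact: rintegrableB..|].
by rewrite !RintegralB// e e'.
Qed.

Lemma same_mean_sum (I : Type) (s : seq I) (f f' : I -> Omega -> R) :
  (forall i, same_mean (f i) (f' i)) ->
  same_mean (fun w => \sum_(i <- s) f i w) (fun w => \sum_(i <- s) f' i w).
Proof.
move=> fi; elim: s => [|i s IH].
  under eq_fun do rewrite big_nil; under [X in same_mean _ X]eq_fun do rewrite big_nil.
  exact/same_mean_refl/rintegrable_cst.
under eq_fun do rewrite big_cons; under [X in same_mean _ X]eq_fun do rewrite big_cons.
exact: same_meanD.
Qed.

Lemma same_mean_ae_eq f g : measurable_fun setT g ->
  (\forall w \ae Pr, f w = g w) -> rintegrable f -> same_mean f g.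
Proof.
move=> mg fg fi; split => //; first exact: rintegrable_ae_eq fi.
by apply: Rintegral_ae_eq => //; exact: rintegrable_measurable.
Qed.

Definition sqintegrable f : Prop :=
  measurable_fun setT f /\ rintegrable (fun w => f w ^+ 2).

Lemma rintegrableM f g : sqintegrable f -> sqintegrable g ->
  rintegrable (fun w => f w * g w).
Proof.
move=> [mf f2] [mg g2].
apply: (rintegrable_ae_le (g := fun w => f w ^+ 2 + g w ^+ 2)).
- exact: measurable_funM.
- exact: rintegrableD.
- apply: aeW => w; rewrite ler_norml; apply/andP; split; nra.
Qed.

Lemma rintegrable_bM b c f : measurable_fun setT b ->
  (\forall w \ae Pr, `|b w| <= c) -> rintegrable f ->
  rintegrable (fun w => b w * f w).
Proof.
move=> mb bc fi.
apply: (rintegrable_ae_le (g := fun w => c * `|f w|)).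
- exact/measurable_funM/rintegrable_measurable.
- exact/rintegrableZ/rintegrable_norm.
- by apply: filterS bc => w bc; rewrite normrM ler_wpM2r.
Qed.

Lemma sqintegrable_cst c : sqintegrable (cst c).
Proof. by split=> //; exact: (rintegrable_cst (c ^+ 2)). Qed.

Lemma sqintegrable_rintegrable f : sqintegrable f -> rintegrable f.
Proof.
move=> f2; have := rintegrableM (sqintegrable_cst 1) f2.
by under eq_fun do rewrite mul1r.
Qed.

Lemma sqintegrableD f g : sqintegrable f -> sqintegrable g ->
  sqintegrable (fun w => f w + g w).
Proof.
move=> [mf f2] [mg g2]; split; first exact: measurable_funD.
apply: (rintegrable_ae_le (g := fun w => 2 * (f w ^+ 2 + g w ^+ 2))).
- exact/measurable_funX/measurable_funD.
- exact/rintegrableZ/rintegrableD.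
- apply: aeW => w; rewrite ger0_norm ?sqr_ge0//.
  by have := sqr_ge0 (f w - g w); nra.
Qed.

Lemma sqintegrable_bM b c f : measurable_fun setT b ->
  (\forall w \ae Pr, `|b w| <= c) -> sqintegrable f ->
  sqintegrable (fun w => b w * f w).
Proof.
move=> mb bc [mf f2]; split; first exact: measurable_funM.
under eq_fun do rewrite exprMn.
apply: (rintegrable_bM (c := c ^+ 2)) f2 => //.
  exact: measurable_funX.
apply: filterS bc => w bc; rewrite normrX lerXn2r ?nnegrE//.
exact: le_trans bc.
Qed.

Lemma sqintegrable_sum (I : Type) (s : seq I) (f : I -> Omega -> R) :
  (forall i, sqintegrable (f i)) -> sqintegrable (fun w => \sum_(i <- s) f i w).
Proof.
move=> fi; elim: s => [|i s IH].
  by under eq_fun do rewrite big_nil; exact: sqintegrable_cst.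
by under eq_fun do rewrite big_cons; exact: sqintegrableD.
Qed.

End SameMean.

(** * Conditional expectation: existence, and pulling out unbounded measurable factors *)

Section ConditionalExpectation.
Context (R : realType) (d : measure_display) (Omega : measurableType d).
Variables (Pr : probability Omega R) (gen : set (set Omega)).
Hypothesis gen_sub : <<s gen >> `<=` measurable.

(** A second measurable structure on [Omega], whose measurable sets are those of the
    sub-sigma-algebra; simple functions and Radon-Nikodym derivatives over [F] are thereby adapted
    to it. *)
Let F := g_sigma_algebraType gen.

Lemma sub_measurableP (X : Omega -> R) :
  sub_measurable <<s gen >> X <-> measurable_fun (setT : set F) (X : F -> R).
Proof.
split=> [mX _ B mB|mX B mB]; first by rewrite setTI; exact: mX.
by rewrite -[X in _ X]setTI; exact: mX.
Qed.

Lemma sub_measurable_measurable (X : Omega -> R) :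
  sub_measurable <<s gen >> X -> measurable_fun setT X.
Proof. by move=> mX _ B mB; rewrite setTI; apply: gen_sub; exact: mX. Qed.

(** The symmetric half of [is_cond_exp]. Symmetry lets the same estimates bound Z E[X | F] by Z X
    and Z X by Z E[X | F]. *)
Definition same_mean_on (X Y : Omega -> R) : Prop :=
  [/\ rintegrable Pr X, rintegrable Pr Y & forall A, <<s gen >> A ->
    \int[Pr]_(w in A) (X w)%:E = \int[Pr]_(w in A) (Y w)%:E]%E.

Lemma rintegrable_indicM (A : set Omega) (X : Omega -> R) : measurable A ->
  rintegrable Pr X -> rintegrable Pr (fun w => \1_A w * X w).
Proof.
move=> mA Xi; apply: (rintegrable_bM (c := 1)) => //.
by apply: aeW => w; rewrite indicE; case: (_ \in _); rewrite ?normr1 ?normr0.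
Qed.

Lemma integral_indicM (A : set Omega) (X : Omega -> R) :
  (\int[Pr]_w (\1_A w * X w)%:E = \int[Pr]_(w in A) (X w)%:E)%E.
Proof.
rewrite [RHS]integral_mkcond; apply: eq_integral => w _.
by rewrite patchE indicE; case: (_ \in _); rewrite ?mul1r ?mul0r.
Qed.

Lemma same_mean_on_indic (X Y : Omega -> R) A :
  same_mean_on X Y -> <<s gen >> A ->
  same_mean_on (fun w => \1_A w * X w) (fun w => \1_A w * Y w).
Proof.
move=> [Xi Yi XY] FA; have mA := gen_sub FA; split; [exact: rintegrable_indicM..|].
move=> B FB.
rewrite -[LHS]integral_indicM -[RHS]integral_indicM.
under eq_integral do rewrite mulrA.
under [RHS]eq_integral do rewrite mulrA.
have E w : \1_B w * \1_A w = \1_(B `&` A) w :> R.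
  by rewrite -[RHS]/((\1_(B `&` A) : _ -> R) w) indicI.
under eq_integral do rewrite E.
under [RHS]eq_integral do rewrite E.
rewrite !integral_indicM; apply: XY.
exact: (@measurableI _ F).
Qed.

Import HBNNSimple.

(** A simple function is a finite combination of indicators of its level sets, which belong to the
    sub-sigma-algebra, so the claim reduces to integrals over those sets. *)
Lemma same_mean_nnsfun (h : {nnsfun F >-> R}) (X Y : Omega -> R) :
  same_mean_on X Y ->
  same_mean Pr (fun w => h w * X w) (fun w => h w * Y w).
Proof.
move=> XY.
have E w : h w =
    \sum_(y <- finmap.enum_fset (fset_set (range h))) y * \1_(h @^-1` [set y]) w.
  by rewrite [LHS]fimfunE fsbig_finite.
under eq_fun do rewrite E mulr_suml.
under [X in same_mean _ _ X]eq_fun do rewrite E mulr_suml.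
apply: same_mean_sum => y.
under eq_fun do rewrite -mulrA.
under [X in same_mean _ _ X]eq_fun do rewrite -mulrA.
apply: same_meanZ.
have mA : <<s gen >> (h @^-1` [set y]) by exact: (@measurable_sfunP _ _ F R h).
have [X1 Y1 XY1] := same_mean_on_indic XY mA.
split=> //; congr fine; apply: XY1; exact: (@measurableT _ F).
Qed.

Lemma nnsfun_approx_sub_measurable (Z : Omega -> R) :
  sub_measurable <<s gen >> Z -> (forall w, 0 <= Z w) ->
  exists h : nat -> {nnsfun F >-> R},
    [/\ forall w, (h n w)%:E @[n --> \oo] --> (Z w)%:E,
        forall w, nondecreasing_seq (fun n => h n w) &
        forall n w, h n w <= Z w].
Proof.
move=> /sub_measurableP mZ Z0.
have mEZ : measurable_fun (setT : set F) (EFin \o Z : F -> \bar R).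
  exact/measurable_EFinP.
pose h := nnsfun_approx (@measurableT _ F) mEZ.
have h_Z w : (h n w)%:E @[n --> \oo] --> (Z w)%:E.
  by apply: (cvg_nnsfun_approx (@measurableT _ F) mEZ) => // ? _; rewrite lee_fin.
have h_nd w : nondecreasing_seq (fun n => h n w).
  by move=> a b ab; have /lefP := nd_nnsfun_approx (@measurableT _ F) mEZ ab; exact.
exists h; split => // n w.
rewrite -lee_fin; apply: cvge_to_ge (h_Z w) _.
by exists n => // k nk; rewrite lee_fin h_nd.
Qed.

(** With simple h_n increasing to Z, monotone convergence (which needs [Y] nonnegative, but no sign
    of [X]) gives the integral of Z Y as the limit of those of h_n Y. Each equals the integral of
    h_n X, which is at most that of |Z X|. *)
Lemma ge0_integral_le_same_mean_on (X Y Z : Omega -> R) :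
  same_mean_on X Y -> (forall w, 0 <= Y w) ->
  sub_measurable <<s gen >> Z -> (forall w, 0 <= Z w) ->
  (\int[Pr]_w (Z w * Y w)%:E <= \int[Pr]_w (`|Z w * X w|)%:E)%E.
Proof.
move=> XY Y0 mZ Z0; have mZ' := sub_measurable_measurable mZ.
have [Xi Yi _] := XY.
have [h [h_Z h_nd h_le]] := nnsfun_approx_sub_measurable mZ Z0.
have cv : (\int[Pr]_w (h n w * Y w)%:E)%E @[n --> \oo] -->
    (\int[Pr]_w (Z w * Y w)%:E)%E.
  have E : (\int[Pr]_w (Z w * Y w)%:E =
      \int[Pr]_w limn (fun n => (h n w * Y w)%:E))%E.
    apply: eq_integral => w _; apply/esym/cvg_lim => //.
    under eq_fun do rewrite EFinM; rewrite EFinM.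
    by apply: cvgeZr.
  rewrite E; apply: cvg_monotone_convergence => //.
  - move=> n; have [_ hY _] := same_mean_nnsfun (h n) XY.
    exact: measurable_int hY.
  - by move=> n w _; rewrite lee_fin mulr_ge0.
  - by move=> w _ a b ab; rewrite lee_fin ler_wpM2r// h_nd.
rewrite -(cvg_lim _ cv)//; apply: lime_le; first by apply/cvg_ex; eexists; exact: cv.
apply: nearW => n.
have [hX hY e] := same_mean_nnsfun (h n) XY.
have -> : (\int[Pr]_w (h n w * Y w)%:E = \int[Pr]_w (h n w * X w)%:E)%E.
  rewrite -[LHS]fineK ?integrable_fin_num// -[RHS]fineK ?integrable_fin_num//.
  by congr EFin; rewrite -[LHS]e.
rewrite (le_trans (lee_abs _))//.
apply: (le_trans (le_abse_integral _ _ _)) => //.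
  exact: measurable_int hX.
apply: ge0_le_integral => //.
- exact/measurableT_comp/(measurable_int _ hX).
- apply/measurable_EFinP/measurableT_comp => //.
  by apply: measurable_funM => //; exact: rintegrable_measurable Xi.
- move=> w _ /=; rewrite lee_fin !normrM ler_wpM2r//.
  by rewrite !ger0_norm.
Qed.

Lemma ge0_rintegrable_same_mean_on (X Y Z : Omega -> R) :
  same_mean_on X Y -> (forall w, 0 <= Y w) ->
  sub_measurable <<s gen >> Z -> (forall w, 0 <= Z w) ->
  rintegrable Pr (fun w => Z w * X w) -> rintegrable Pr (fun w => Z w * Y w).
Proof.
move=> XY Y0 mZ Z0 /integrableP[_ ZX]; have [_ /rintegrable_measurable mY _] := XY.
apply: rintegrable_lty.
  exact/measurable_funM/mY/sub_measurable_measurable.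
apply: le_lt_trans ZX.
under eq_integral do rewrite ger0_norm ?mulr_ge0//.
exact: ge0_integral_le_same_mean_on.
Qed.

Lemma same_mean_onZ c X Y : same_mean_on X Y ->
  same_mean_on (fun w => c * X w) (fun w => c * Y w).
Proof.
move=> [Xi Yi e]; split; [exact: rintegrableZ..|] => A FA.
have mA := gen_sub FA.
under eq_integral do rewrite EFinM.
under [RHS]eq_integral do rewrite EFinM.
by rewrite !integralZl ?e//; exact: (integrableS measurableT).
Qed.

(** The set A where Y is nonnegative lies in the sub-sigma-algebra, so the positive and negative
    parts of Y have the same means on its sets as 1_A X and -1_{~A} X. The nonnegative case applies
    to each, with |Z| as factor, and |Z Y| is the sum of the two products. *)
Lemma pull_out_rintegrable (X Y Z : Omega -> R) :
  same_mean_on X Y -> sub_measurable <<s gen >> Y ->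
  sub_measurable <<s gen >> Z ->
  rintegrable Pr (fun w => Z w * X w) -> rintegrable Pr (fun w => Z w * Y w).
Proof.
move=> XY mY mZ ZX.
have mYO := sub_measurable_measurable mY.
have mZO := sub_measurable_measurable mZ.
have mX : measurable_fun setT X by case: XY => /rintegrable_measurable.
have mZn : sub_measurable <<s gen >> (fun w => `|Z w|).
  by apply/sub_measurableP/measurableT_comp => //; exact/sub_measurableP.
pose A := Y @^-1` `[0, +oo[.
have FA : <<s gen >> A by exact: mY.
have FAC : <<s gen >> (~` A) by exact: (@measurableC _ F).
have iA : rintegrable Pr (fun w => `|Z w| * (\1_A w * Y w)).
  apply: ge0_rintegrable_same_mean_on (same_mean_on_indic XY FA) _ mZn _ _ => // [w|].
    rewrite indicE; case: (boolP (w \in A)) => [/set_mem|_]; last by rewrite mul0r.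
    by rewrite /A /= in_itv/= andbT mul1r.
  apply: rintegrable_ae_le (rintegrable_norm ZX) _.
    apply: measurable_funM; first exact: measurableT_comp.
    by apply: measurable_funM => //; exact/measurable_indic/gen_sub.
  apply: aeW => w; rewrite !normrM normr_id ler_wpM2l// ler_piMl//.
  by rewrite indicE; case: (_ \in _); rewrite ?normr1 ?normr0.
have iAC : rintegrable Pr (fun w => `|Z w| * (\1_(~` A) w * (-1 * Y w))).
  have NXY := same_mean_on_indic (same_mean_onZ (-1) XY) FAC.
  apply: ge0_rintegrable_same_mean_on NXY _ mZn _ _ => // [w|].
    rewrite indicE in_setC; case: (boolP (w \in A)) => [_|]; first by rewrite mul0r.
    rewrite notin_setE /A /= in_itv/= andbT => /negP.
    by rewrite -ltNge mul1r mulN1r oppr_ge0; exact: ltW.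
  apply: rintegrable_ae_le (rintegrable_norm ZX) _.
    apply: measurable_funM; first exact: measurableT_comp.
    apply: measurable_funM; first exact/measurable_indic/gen_sub.
    exact: measurable_funM.
  apply: aeW => w; rewrite !normrM normr_id normrN1 mul1r ler_wpM2l// ler_piMl//.
  by rewrite indicE; case: (_ \in _); rewrite ?normr1 ?normr0.
apply: rintegrable_ae_le (rintegrableD iA iAC) _; first exact: measurable_funM.
apply: aeW => w; rewrite normrM -mulrDr ler_wpM2l// !indicE in_setC.
case: (boolP (w \in A)) => [/set_mem|].
  by rewrite /A /= in_itv/= andbT => Y0; rewrite mul1r mul0r addr0 ger0_norm.
rewrite notin_setE /A /= in_itv/= andbT => /negP; rewrite -ltNge => Y0.
by rewrite mul1r mul0r add0r mulN1r ltr0_norm.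
Qed.

(** Now that Z X and Z Y are both integrable, |Z X| and |Z Y| dominate h_n X and h_n Y for simple
    h_n increasing to Z, and dominated convergence passes to the limit without any sign of X or
    Y. *)
Lemma ge0_pull_out (X Y Z : Omega -> R) :
  same_mean_on X Y -> sub_measurable <<s gen >> Z -> (forall w, 0 <= Z w) ->
  rintegrable Pr (fun w => Z w * X w) -> rintegrable Pr (fun w => Z w * Y w) ->
  same_mean Pr (fun w => Z w * X w) (fun w => Z w * Y w).
Proof.
move=> XY mZ Z0 ZX ZY; split => //; congr fine.
have [h [h_Z _ h_le]] := nnsfun_approx_sub_measurable mZ Z0.
have cv (V : Omega -> R) : rintegrable Pr (fun w => Z w * V w) ->
    (forall n, rintegrable Pr (fun w => h n w * V w)) ->
  (\int[Pr]_w (h n w * V w)%:E)%E @[n --> \oo] --> (\int[Pr]_w (Z w * V w)%:E)%E.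
  move=> ZV hV.
  have f_f : {ae Pr, forall w, setT w ->
      (h n w * V w)%:E @[n --> \oo] --> (Z w * V w)%:E}.
    apply: aeW => w _; under eq_fun do rewrite EFinM.
    by rewrite EFinM; apply: cvgeZr.
  have f_g : {ae Pr, forall w n, setT w -> (`|(h n w * V w)%:E| <= `|Z w * V w|%:E)%E}.
    by apply: aeW => w n _; rewrite lee_fin !normrM ler_wpM2r// !ger0_norm.
  by have [] := dominated_convergence measurableT (fun n => measurable_int _ (hV n))
    (measurable_int _ ZV) f_f (rintegrable_norm ZV) f_g.
have hE n := same_mean_nnsfun (h n) XY.
rewrite -(cvg_lim (@ereal_hausdorff R) (cv X _ _))//; last by move=> n; case: (hE n).
rewrite -(cvg_lim (@ereal_hausdorff R) (cv Y _ _))//; last by move=> n; case: (hE n).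
congr (limn _); apply/funext => n; have [hX hY e] := hE n.
rewrite -[LHS]fineK ?integrable_fin_num// -[RHS]fineK ?integrable_fin_num//.
by congr EFin.
Qed.

(** Z is split into positive and negative parts; both are at most |Z|, so their products with X
    inherit integrability from Z X. *)
Lemma pull_out (X Y Z : Omega -> R) :
  is_cond_exp Pr <<s gen >> X Y -> sub_measurable <<s gen >> Z ->
  rintegrable Pr (fun w => Z w * X w) ->
  same_mean Pr (fun w => Z w * X w) (fun w => Z w * Y w).
Proof.
move=> [Xi mY Yi YX] mZ ZX.
have XY : same_mean_on X Y by split => // A FA; rewrite YX.
have part (Z' : Omega -> R) : sub_measurable <<s gen >> Z' ->
    (forall w, 0 <= Z' w <= `|Z w|) ->
    same_mean Pr (fun w => Z' w * X w) (fun w => Z' w * Y w).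
  move=> mZ' Z'Z.
  have Z'0 w : 0 <= Z' w by case/andP: (Z'Z w).
  have Z'X : rintegrable Pr (fun w => Z' w * X w).
    apply: rintegrable_ae_le (rintegrable_norm ZX) _.
      apply: measurable_funM; first exact: sub_measurable_measurable.
      exact: rintegrable_measurable Xi.
    apply: aeW => w; rewrite !normrM ler_wpM2r// ger0_norm//.
    by case/andP: (Z'Z w).
  apply: ge0_pull_out => //; exact: pull_out_rintegrable XY mY mZ' Z'X.
have mZF := (sub_measurableP _).1 mZ.
have E w : Z w = Num.max (Z w) 0 - Num.max (- Z w) 0.
  case: (leP 0 (Z w)) => h; case: (leP (- Z w) 0) => h'; lra.
have p1 : same_mean Pr (fun w => Num.max (Z w) 0 * X w)
    (fun w => Num.max (Z w) 0 * Y w).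
  apply: part => [|w]; first by apply/sub_measurableP; exact: measurable_maxr.
  by rewrite le_max lexx orbT ge_max ler_norm normr_ge0.
have p2 : same_mean Pr (fun w => Num.max (- Z w) 0 * X w)
    (fun w => Num.max (- Z w) 0 * Y w).
  apply: part => [|w].
    apply/sub_measurableP; apply: measurable_maxr => //.
    exact: measurableT_comp.
  by rewrite le_max lexx orbT ge_max -normrN ler_norm normr_ge0.
have := same_meanB p1 p2.
under eq_fun do rewrite -mulrBl -E.
by under [X in same_mean _ _ X]eq_fun do rewrite -mulrBl -E.
Qed.

(** The converse transfer, from the conditional expectation to the variable. It serves with X the
    squared noise and Y = 1, to show that noise times an adapted square-integrable factor is
    square-integrable. *)
Lemma ge0_rintegrable_pull_in (X Y Z : Omega -> R) :
  is_cond_exp Pr <<s gen >> X Y -> (forall w, 0 <= X w) ->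
  sub_measurable <<s gen >> Z -> (forall w, 0 <= Z w) ->
  rintegrable Pr (fun w => Z w * Y w) -> rintegrable Pr (fun w => Z w * X w).
Proof.
move=> [Xi mY Yi YX] X0 mZ Z0; exact: ge0_rintegrable_same_mean_on.
Qed.

(** Existence comes from Radon-Nikodym: the charge A |-> integral of X over A, restricted to the
    sub-sigma-algebra, has a density with respect to the restriction of [Pr]. *)
Lemma cond_expP (X : Omega -> R) : rintegrable Pr X ->
  is_cond_exp Pr <<s gen >> X (cond_exp Pr <<s gen >> X).
Proof.
move=> Xi.
suff [Y XY] : exists Y, is_cond_exp Pr <<s gen >> X Y.
  by apply: (@xgetPex _ (cst 0) [set Y | is_cond_exp Pr <<s gen >> X Y]); exists Y.
have mi : measurable_fun setT (id : Omega -> F).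
  by move=> _ A FA; rewrite setTI; exact: gen_sub.
pose i : {mfun Omega >-> F} :=
  HB.pack (id : Omega -> F) (isMeasurableFun.Build _ _ _ _ _ mi).
(* Restriction to the sub-sigma-algebra is encoded as push-forward along the identity map from
   [Omega] to [F], for the measure and for the charge alike. *)
pose mu : probability F R := distribution Pr i.
pose nu : {charge set F -> \bar R} :=
  measure_function_pushforward__canonical__charge_Charge (induced_charge Xi) mi.
have nu_mu : nu `<< mu.
  apply/null_content_dominatesP => A FA muA; apply: null_set_integral => //.
  - exact: gen_sub.
  - exact/measurable_funTS/(measurable_int _ Xi).
pose Y := Radon_Nikodym nu mu.
have Yfin w : Y w \is a fin_num by exact: Radon_Nikodym_fin_num.
have Yi := Radon_Nikodym_integrable nu_mu.
have mY : measurable_fun (setT : set F) Y by exact: measurable_int Yi.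
have EY : (EFin \o (fine \o Y) : F -> _) = Y by apply/funext => w /=; rewrite fineK.
have mfY : measurable_fun (setT : set F) (fine \o Y).
  by apply/measurable_EFinP; rewrite EY.
have fYi : rintegrable Pr (fine \o Y).
  apply: rintegrable_lty.
    by apply: sub_measurable_measurable; exact/sub_measurableP.
  move/integrableP: Yi => [_]; rewrite ge0_integral_distribution//.
    apply: le_lt_trans; rewrite le_eqVlt; apply/orP; left; apply/eqP.
    apply: eq_integral => w _ /=.
    by transitivity (`|(fine (Y w))%:E|)%E => //; rewrite fineK.
  exact: measurableT_comp.
exists (fine \o Y); split => //; first exact/sub_measurableP.
move=> A FA; rewrite -[RHS]/(nu A) (Radon_Nikodym_integral nu_mu FA).
have YA : Pr.-integrable (i @^-1` A) (Y \o i).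
  apply: (integrableS measurableT) => //; first exact: gen_sub.
  by have : rintegrable Pr (fine \o Y) by []; rewrite /rintegrable EY.
rewrite [RHS](integral_pushforward _ _ YA)//.
by apply: eq_integral => w _ /=; rewrite fineK.
Qed.

(* Almost everywhere equal arguments have the same conditional expectations, so
   the choice operator selects the same version for both. *)
Lemma cond_exp_ae_eq (X X' : Omega -> R) :
  measurable_fun setT X -> measurable_fun setT X' ->
  (\forall w \ae Pr, X w = X' w) ->
  cond_exp Pr <<s gen >> X = cond_exp Pr <<s gen >> X'.
Proof.
move=> mX mX' XX'.
have half (U V : Omega -> R) : measurable_fun setT U -> measurable_fun setT V ->
    (\forall w \ae Pr, U w = V w) ->
    [set Y | is_cond_exp Pr <<s gen >> U Y] `<=` [set Y | is_cond_exp Pr <<s gen >> V Y].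
  move=> mU mV UV Y [Ui mY Yi YU]; split=> // [|A FA].
    exact: rintegrable_ae_eq Ui.
  rewrite YU//; apply: ae_eq_integral.
  - exact: gen_sub.
  - exact/measurable_funTS/measurable_EFinP.
  - exact/measurable_funTS/measurable_EFinP.
  - by apply: filterS UV => w -> _.
rewrite /cond_exp; congr (xget _ _); apply/seteqP; split; apply: half => //.
by apply: filterS XX' => w ->.
Qed.

End ConditionalExpectation.

(** * Linear algebra: Euclidean products, strongly regular matrices, completion of squares *)

Section DotProduct.
Context (R : realType).

Lemma dotvE n (x y : 'cV[R]_n) : dotv x y = \sum_i x i 0 * y i 0.
Proof. by rewrite /dotv mxE; apply: eq_bigr => i _; rewrite mxE. Qed.

Lemma dotvC n (x y : 'cV[R]_n) : dotv x y = dotv y x.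
Proof. by rewrite !dotvE; apply: eq_bigr => i _; rewrite mulrC. Qed.

Lemma dotvDl n (x y z : 'cV[R]_n) : dotv (x + y) z = dotv x z + dotv y z.
Proof. by rewrite /dotv linearD/= mulmxDl mxE. Qed.

Lemma dotvDr n (x y z : 'cV[R]_n) : dotv z (x + y) = dotv z x + dotv z y.
Proof. by rewrite /dotv mulmxDr mxE. Qed.

Lemma dotvZl n c (x y : 'cV[R]_n) : dotv (c *: x) y = c * dotv x y.
Proof. by rewrite /dotv linearZ/= -scalemxAl mxE. Qed.

Lemma dotvZr n c (x y : 'cV[R]_n) : dotv x (c *: y) = c * dotv x y.
Proof. by rewrite dotvC dotvZl dotvC. Qed.

Lemma dotvNl n (x y : 'cV[R]_n) : dotv (- x) y = - dotv x y.
Proof. by rewrite -scaleN1r dotvZl mulN1r. Qed.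

Lemma dotv0l n (x : 'cV[R]_n) : dotv 0 x = 0.
Proof. by rewrite -(scale0r 0) dotvZl mul0r. Qed.

Lemma dotv0r n (x : 'cV[R]_n) : dotv x 0 = 0.
Proof. by rewrite dotvC dotv0l. Qed.

Lemma dotv_trmul n p (M : 'M[R]_(n, p)) (x : 'cV[R]_n) (y : 'cV[R]_p) :
  dotv (M^T *m x) y = dotv x (M *m y).
Proof. by rewrite /dotv trmx_mul trmxK mulmxA. Qed.

Lemma dotv_gt0 n (x : 'cV[R]_n) : x != 0 -> 0 < dotv x x.
Proof.
move=> x0; rewrite lt_neqAle eq_sym dotvE sumr_ge0 ?andbT; last first.
  by move=> i _; rewrite -expr2 sqr_ge0.
apply: contra x0; rewrite psumr_eq0; last by move=> i _; rewrite -expr2 sqr_ge0.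
move=> /allP x0; apply/eqP/matrixP => i j; rewrite ord1 mxE.
by have := x0 i (mem_index_enum _); rewrite -expr2 sqrf_eq0 => /eqP.
Qed.

Lemma symmx_dotv n (M : 'M[R]_n) (x y : 'cV[R]_n) : symmx M ->
  dotv (M *m x) y = dotv (M *m y) x.
Proof. by move=> sM; rewrite -{1}sM dotv_trmul dotvC. Qed.

End DotProduct.

Section Regularity.
Context (R : realType).

(** A nonzero x with U x = 0 would give <(U - delta) x, x> = - delta <x, x> < 0. Since [kermx] is
    the left kernel, such vectors are transposed rows of [kermx U^T]. *)
Lemma regular_unitmx p (U : 'M[R]_p) delta : 0 < delta ->
  pdmx (U - delta%:M) -> U \in unitmx.
Proof.
move=> d0 [_ U0]; rewrite -unitmx_tr -row_free_unit -kermx_eq0.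
apply/eqP/row_matrixP => i; rewrite row0; apply/eqP/negPn/negP => Ki.
have x0 : (row i (kermx U^T))^T != 0.
  by apply: contra Ki => /eqP/(congr1 trmx); rewrite trmxK trmx0 => ->.
have := U0 _ x0; rewrite mulmxBl mul_scalar_mx.
have -> : U *m (row i (kermx U^T))^T = 0.
  by apply: trmx_inj; rewrite trmx_mul trmxK trmx0 -row_mul mulmx_ker row0.
by rewrite sub0r dotvNl dotvZl oppr_gt0 pmulr_rlt0// ltNge ltW ?dotv_gt0.
Qed.

Lemma regular_symmx p (U : 'M[R]_p) delta : pdmx (U - delta%:M) -> symmx U.
Proof.
move=> [+ _]; rewrite /symmx linearB/= tr_scalar_mx => /(congr1 (+%R^~ delta%:M)).
by rewrite !subrK.
Qed.

Lemma regular_ge0 p (U : 'M[R]_p) delta x : 0 < delta ->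
  pdmx (U - delta%:M) -> 0 <= dotv (U *m x) x.
Proof.
move=> d0 [_ U0]; have [->|x0] := eqVneq x 0; first by rewrite dotv0r.
have := U0 _ x0; rewrite mulmxBl mul_scalar_mx dotvDl dotvNl dotvZl.
by have := dotv_gt0 x0; nra.
Qed.

End Regularity.

(* The coefficients of the Riccati and backward equations of either player, in
   the notation of player 1; [t j] and [f j] stand for the conditional moments
   [E[T_{k+1} omega_k^j | F_{k-1}]] and [E[phi_{k+1} omega_k^j | F_{k-1}]]. *)
Section CompletionOfSquares.
Context (R : realType) (n p : nat).
Variables (A D : 'M[R]_n) (B E : 'M[R]_(n, p)) (a s : 'cV[R]_n).
Variables (Q : 'M[R]_n) (L : 'M[R]_(p, n)) (S : 'M[R]_p).
Variables (q : 'cV[R]_n) (rho : 'cV[R]_p).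
Variables (t : nat -> 'M[R]_n) (f : nat -> 'cV[R]_n).

Definition lq_Upsilon : 'M[R]_p :=
  S + B^T *m t 0 *m B + B^T *m t 1 *m E + E^T *m t 1 *m B + E^T *m t 2 *m E.

Definition lq_Lambda : 'M[R]_(p, n) :=
  L + B^T *m t 0 *m A + E^T *m t 1 *m A + B^T *m t 1 *m D + E^T *m t 2 *m D.

Definition lq_Delta : 'M[R]_n :=
  Q + A^T *m t 0 *m A + A^T *m t 1 *m D + D^T *m t 1 *m A + D^T *m t 2 *m D.

Definition lq_Phi : 'cV[R]_p :=
  rho + B^T *m (t 0 *m a + t 1 *m s + f 0) + E^T *m (t 1 *m a + t 2 *m s + f 1).

Definition lq_Theta : 'cV[R]_n :=
  q + A^T *m (t 0 *m a + t 1 *m s + f 0) + D^T *m (t 1 *m a + t 2 *m s + f 1).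

Definition stage_cost (x : 'cV[R]_n) (u : 'cV[R]_p) : R :=
  dotv (Q *m x) x + 2 * dotv (L^T *m u) x + dotv (S *m u) u +
  2 * dotv q x + 2 * dotv rho u.

(** The mean of <T_{k+1} h, h> + 2 <phi_{k+1}, h> given F_{k-1}, for h = y + omega_k z with y and z
    known at that time, expanded in powers of omega_k. *)
Definition moment_cost (y z : 'cV[R]_n) : R :=
  dotv (t 0 *m y) y + (dotv (t 1 *m y) z + dotv (t 1 *m z) y) +
  dotv (t 2 *m z) z + 2 * dotv (f 0) y + 2 * dotv (f 1) z.

Lemma stage_moment_cost x u : (forall j, symmx (t j)) ->
  stage_cost x u + moment_cost (A *m x + B *m u + a) (D *m x + E *m u + s)
  = dotv (lq_Delta *m x) x + 2 * dotv (lq_Lambda *m x) u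
    + dotv (lq_Upsilon *m u) u + 2 * dotv lq_Theta x + 2 * dotv lq_Phi u
    + moment_cost a s.
Proof.
move=> ts.
rewrite /stage_cost /moment_cost /lq_Delta /lq_Lambda /lq_Upsilon /lq_Theta /lq_Phi.
rewrite dotv_trmul [dotv u (L *m x)]dotvC.
rewrite !mulmxDl -!mulmxA !mulmxDr !dotvDl !dotv_trmul.
set ax := A *m x; set bu := B *m u; set dx := D *m x; set eu := E *m u.
rewrite ?dotvDl ?dotvDr ?dotvDl.
(* Symmetry of the moments orients every mixed product the same way, so that [ring] sees equal atoms
   and merges cross terms into the doubled ones. *)
rewrite (symmx_dotv bu ax (ts 0)) (symmx_dotv a ax (ts 0)) (symmx_dotv a bu (ts 0)).
rewrite (symmx_dotv eu dx (ts 2)) (symmx_dotv s dx (ts 2)) (symmx_dotv s eu (ts 2)).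
rewrite ?(symmx_dotv dx ax (ts 1)) ?(symmx_dotv eu ax (ts 1)) ?(symmx_dotv s ax (ts 1)).
rewrite ?(symmx_dotv dx bu (ts 1)) ?(symmx_dotv eu bu (ts 1)) ?(symmx_dotv s bu (ts 1)).
rewrite ?(symmx_dotv dx a (ts 1)) ?(symmx_dotv eu a (ts 1)) ?(symmx_dotv s a (ts 1)).
ring.
Qed.

Lemma complete_square (Del T : 'M[R]_n) (Lam : 'M[R]_(p, n)) (Ups : 'M[R]_p)
    (The phi : 'cV[R]_n) (Phi : 'cV[R]_p) x u :
  symmx Ups -> Ups \in unitmx ->
  T = Del - Lam^T *m invmx Ups *m Lam -> phi = The - Lam^T *m invmx Ups *m Phi ->
  let v := u + invmx Ups *m (Lam *m x + Phi) in
  dotv (Del *m x) x + 2 * dotv (Lam *m x) u + dotv (Ups *m u) u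
    + 2 * dotv The x + 2 * dotv Phi u
  = dotv (T *m x) x + 2 * dotv phi x
    + (dotv (Ups *m v) v - dotv Phi (invmx Ups *m Phi)).
Proof.
move=> sU uU -> -> v.
(* Writing Lam x = Ups v1 and Phi = Ups v2 removes the inverse: what remains is an expansion of the
   symmetric form of [Ups] at u + v1 + v2. *)
pose v1 := invmx Ups *m (Lam *m x); pose v2 := invmx Ups *m Phi.
have U1 : Lam *m x = Ups *m v1 by rewrite /v1 mulKVmx.
have U2 : Phi = Ups *m v2 by rewrite /v2 mulKVmx.
rewrite mulmxBl -!mulmxA -/v1 -/v2 !dotvDl !dotvNl !dotv_trmul.
have -> : v = u + (v1 + v2) by rewrite /v mulmxDr.
rewrite !mulmxDr !dotvDl !dotvDr U1 {1 2}U2.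
rewrite (symmx_dotv v1 u sU) (symmx_dotv v2 u sU) (symmx_dotv v2 v1 sU).
rewrite [dotv v1 _]dotvC [dotv v2 (Ups *m _)]dotvC.
ring.
Qed.

End CompletionOfSquares.

(** * The verification argument for an abstract one-step identity *)

Section Verification.
Context (R : realType) (d : measure_display) (Omega : measurableType d).
Variable Pr : probability Omega R.
Implicit Types f g : Omega -> R.

Lemma expectation_Rintegral f : rintegrable Pr f ->
  'E_Pr[f]%E = (\int[Pr]_w f w)%:E.
Proof. by move=> fi; rewrite unlock fineK// integrable_fin_num. Qed.

Lemma same_mean_expectation f g : same_mean Pr f g -> 'E_Pr[f]%E = 'E_Pr[g]%E.
Proof. by move=> [fi gi e]; rewrite !expectation_Rintegral// e. Qed.

Lemma same_mean_telescope N (V stage rest : nat -> Omega -> R) :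
  rintegrable Pr (V 0%N) ->
  (forall k, (k < N)%N -> [/\ rintegrable Pr (stage k), rintegrable Pr (rest k) &
    same_mean Pr (fun w => stage k w + V k.+1 w) (fun w => V k w + rest k w)]) ->
  same_mean Pr (fun w => V N w + \sum_(k < N) stage k w)
    (fun w => V 0%N w + \sum_(k < N) rest k w).
Proof.
move=> V0; elim: N => [|N IH] step.
  under eq_fun do rewrite big_ord0 addr0.
  under [X in same_mean _ _ X]eq_fun do rewrite big_ord0 addr0.
  exact: same_mean_refl.
have [si ri sV] := step N (ltnSn N).
have {}IH := IH (fun k kN => step k (ltnW kN)).
have stagesi : rintegrable Pr (fun w => \sum_(k < N) stage k w).
  apply: rintegrable_sum => k.
  by have [] := step k (ltnW (ltn_ord k)).
(* Only [V 0] is assumed integrable, so [V N.+1] stays attached to its stage cost, in the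
   combination whose integrability the step hypothesis provides. *)
rewrite (_ : (fun w => V N.+1 w + _) =
    (fun w => \sum_(k < N) stage k w + (stage N w + V N.+1 w))); last first.
  by apply/funext => w; rewrite big_ord_recr/=; ring.
apply: same_mean_trans (same_meanD (same_mean_refl stagesi) sV) _.
rewrite (_ : (fun w => _ + (V N w + _)) =
    (fun w => V N w + \sum_(k < N) stage k w + rest N w)); last first.
  by apply/funext => w; ring.
rewrite (_ : (fun w => V 0%N w + _) =
    (fun w => V 0%N w + \sum_(k < N) rest k w + rest N w)); last first.
  by apply/funext => w; rewrite big_ord_recr/=; ring.
by apply: same_meanD => //; exact: same_mean_refl.
Qed.

(** [dev] is the part depending on the control and [c] the part that does not. Their separate
    integrability makes the mean of [value] a finite lower bound. The cost is given only almost
    surely because the terminal conditions hold almost surely. *)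
Lemma verification N (V stage dev c : nat -> Omega -> R) (cost : Omega -> R) :
  measure_is_complete Pr -> rintegrable Pr (V 0%N) ->
  (\forall w \ae Pr, cost w = V N w + \sum_(k < N) stage k w) ->
  (forall k, (k < N)%N -> [/\ rintegrable Pr (stage k), rintegrable Pr (dev k),
    rintegrable Pr (c k) & same_mean Pr (fun w => stage k w + V k.+1 w)
                             (fun w => V k w + (dev k w + c k w))]) ->
  (forall k, (k < N)%N -> \forall w \ae Pr, 0 <= dev k w) ->
  let value w := V 0%N w + \sum_(k < N) c k w in
  ('E_Pr[value] <= 'E_Pr[cost])%E /\
  ((forall k, (k < N)%N -> \forall w \ae Pr, dev k w = 0) ->
   'E_Pr[cost]%E = 'E_Pr[value]%E).
Proof.
move=> cP V0 costE step dev0 value.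
have tel : same_mean Pr (fun w => V N w + \sum_(k < N) stage k w)
    (fun w => V 0%N w + \sum_(k < N) (dev k w + c k w)).
  apply: (same_mean_telescope (rest := fun k w => dev k w + c k w)) => // k kN.
  by have [si di ci sV] := step k kN; split => //; exact: rintegrableD.
have devi : rintegrable Pr (fun w => \sum_(k < N) dev k w).
  by apply: rintegrable_sum => k; case: (step k (ltn_ord k)).
have valuei : rintegrable Pr value.
  apply: rintegrableD => //; apply: rintegrable_sum => k.
  by case: (step k (ltn_ord k)).
have costV : same_mean Pr cost (fun w => value w + \sum_(k < N) dev k w).
  apply: (same_mean_trans (g := fun w => V N w + \sum_(k < N) stage k w)).
    have {}costE : \forall w \ae Pr, V N w + \sum_(k < N) stage k w = cost w.
      by apply: filterS costE => w ->.
    have [ci _ _] := tel; apply/same_mean_sym/same_mean_ae_eq => //.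
    exact/rintegrable_measurable/(rintegrable_complete cP costE ci).
  rewrite (_ : (fun w => value w + _) =
    (fun w => V 0%N w + \sum_(k < N) (dev k w + c k w)))//.
  by apply/funext => w; rewrite big_split/= /value; ring.
have [costi _ e] := costV.
have ae_all (P : nat -> Omega -> Prop) :
    (forall k, (k < N)%N -> \forall w \ae Pr, P k w) ->
    \forall w \ae Pr, forall k : 'I_N, P k w.
  by move=> NP; apply: filter_forall => k; exact: NP.
split=> [|dev_eq0].
  rewrite !expectation_Rintegral// lee_fin e RintegralD// lerDl.
  apply: Rintegral_ae_ge0; first exact: rintegrable_measurable devi.
  apply: filterS (ae_all _ dev0) => w dw.
  by apply: sumr_ge0 => k _; exact: dw.
apply: same_mean_expectation; apply: same_mean_trans costV _.
apply: same_mean_ae_eq => //.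
- exact: rintegrable_measurable valuei.
- apply: filterS (ae_all _ dev_eq0) => w dw.
  by rewrite big1 ?addr0// => k _; exact: dw.
- exact: rintegrableD.
Qed.

End Verification.

(** * Bounded and square-integrable random matrices, entrywise conditional expectation *)

Section RandomMatrices.
Context (R : realType) (d : measure_display) (Omega : measurableType d).
Variable Pr : probability Omega R.

Definition bounded_mx p q (X : Omega -> 'M[R]_(p, q)) : Prop :=
  forall i j, measurable_fun setT (fun w => X w i j) /\
    exists c : R, \forall w \ae Pr, `|X w i j| <= c.

Definition sqintegrable_mx p q (X : Omega -> 'M[R]_(p, q)) : Prop :=
  forall i j, sqintegrable Pr (fun w => X w i j).

Lemma sqintegrable_mxD p q (X Y : Omega -> 'M[R]_(p, q)) :
  sqintegrable_mx X -> sqintegrable_mx Y -> sqintegrable_mx (fun w => X w + Y w).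
Proof.
by move=> X2 Y2 i j; under eq_fun do rewrite mxE; exact: sqintegrableD.
Qed.

Lemma sqintegrable_mx_mul p q r (X : Omega -> 'M[R]_(p, q))
    (Y : Omega -> 'M[R]_(q, r)) :
  bounded_mx X -> sqintegrable_mx Y -> sqintegrable_mx (fun w => X w *m Y w).
Proof.
move=> Xb Y2 i j; under eq_fun do rewrite mxE.
apply: sqintegrable_sum => k; have [mX [c Xc]] := Xb i k.
exact: sqintegrable_bM mX Xc (Y2 k j).
Qed.

Lemma rintegrable_dotv p (x y : Omega -> 'cV[R]_p) :
  sqintegrable_mx x -> sqintegrable_mx y ->
  rintegrable Pr (fun w => dotv (x w) (y w)).
Proof.
move=> x2 y2; under eq_fun do rewrite dotvE.
by apply: rintegrable_sum => i; exact: rintegrableM.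
Qed.

Lemma rintegrable_form p q (X : Omega -> 'M[R]_(p, q)) (x : Omega -> 'cV[R]_q)
    (y : Omega -> 'cV[R]_p) :
  bounded_mx X -> sqintegrable_mx x -> sqintegrable_mx y ->
  rintegrable Pr (fun w => dotv (X w *m x w) (y w)).
Proof. by move=> Xb x2 y2; apply/rintegrable_dotv/y2/sqintegrable_mx_mul. Qed.

Lemma bounded_mx_tr p q (X : Omega -> 'M[R]_(p, q)) :
  bounded_mx X -> bounded_mx (fun w => (X w)^T).
Proof.
move=> Xb i j; have [mX [c Xc]] := Xb j i.
split; first by under eq_fun do rewrite mxE.
by exists c; apply: filterS Xc => w; rewrite mxE.
Qed.

Lemma bounded_mxD p q (X Y : Omega -> 'M[R]_(p, q)) :
  bounded_mx X -> bounded_mx Y -> bounded_mx (fun w => X w + Y w).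
Proof.
move=> Xb Yb i j; have [mX [c Xc]] := Xb i j; have [mY [c' Yc]] := Yb i j.
split; first by under eq_fun do rewrite mxE; exact: measurable_funD.
exists (c + c'); apply: filterS2 Xc Yc => w Xc Yc; rewrite mxE.
by rewrite (le_trans (ler_normD _ _))// lerD.
Qed.

Lemma bounded_mx_mul p q r (X : Omega -> 'M[R]_(p, q)) (Y : Omega -> 'M[R]_(q, r)) :
  bounded_mx X -> bounded_mx Y -> bounded_mx (fun w => X w *m Y w).
Proof.
move=> Xb Yb i j; split.
  under eq_fun do rewrite mxE; apply: measurable_sum => k.
  by apply: measurable_funM; [case: (Xb i k)|case: (Yb k j)].
have : forall k, exists c : R, \forall w \ae Pr, `|X w i k * Y w k j| <= c.
  move=> k; have [_ [c Xc]] := Xb i k; have [_ [c' Yc]] := Yb k j.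
  exists (c * c'); apply: filterS2 Xc Yc => w Xc Yc.
  by rewrite normrM ler_pM.
move=> /choice[c cP]; exists (\sum_k c k).
have : \forall w \ae Pr, forall k, `|X w i k * Y w k j| <= c k by exact: filter_forall.
apply: filterS => w le_c; rewrite mxE.
by rewrite (le_trans (ler_norm_sum _ _ _))// ler_sum.
Qed.

Lemma enorm_entry p q (M : 'M[R]_(p, q)) i j : `|M i j| <= enorm M.
Proof.
rewrite -sqrtr_sqr ler_wsqrtr// (bigD1 i)//= (bigD1 j)//=.
rewrite -addrA lerDl addr_ge0//; first by apply: sumr_ge0 => k _; exact: sqr_ge0.
by apply: sumr_ge0 => k _; apply: sumr_ge0 => k' _; exact: sqr_ge0.
Qed.

Lemma enorm_sqr p q (M : 'M[R]_(p, q)) : enorm M ^+ 2 = \sum_i \sum_j M i j ^+ 2.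
Proof.
rewrite sqr_sqrtr//; apply: sumr_ge0 => k _; apply: sumr_ge0 => k' _.
exact: sqr_ge0.
Qed.

Lemma sqintegrable_mx_le p q (X : Omega -> 'M[R]_(p, q)) (f : Omega -> R) :
  (forall i j, measurable_fun setT (fun w => X w i j)) ->
  measurable_fun setT f -> (forall w, enorm (X w) ^+ 2 <= f w) ->
  ('E_Pr[f] < +oo)%E -> sqintegrable_mx X.
Proof.
move=> mX mf Xf; rewrite unlock => foo i j; split => //.
have f0 w : 0 <= f w by rewrite (le_trans _ (Xf w))// sqr_ge0.
apply: (rintegrable_ae_le (g := f)).
- exact: measurable_funX.
- by apply: rintegrable_lty => //; under eq_integral do rewrite ger0_norm//.
- apply: aeW => w; rewrite ger0_norm ?sqr_ge0// (le_trans _ (Xf w))//.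
  by rewrite -real_normK ?num_real// lerXn2r ?nnegrE ?sqrtr_ge0// enorm_entry.
Qed.

Lemma rintegrable_enorm p q (X : Omega -> 'M[R]_(p, q)) :
  sqintegrable_mx X -> rintegrable Pr (fun w => enorm (X w) ^+ 2).
Proof.
move=> X2; under eq_fun do rewrite enorm_sqr.
by apply: rintegrable_sum => i; apply: rintegrable_sum => j; case: (X2 i j).
Qed.

Variable gen : set (set Omega).

Lemma sub_measurable_mxD p q (X Y : Omega -> 'M[R]_(p, q)) :
  sub_measurable_mx <<s gen >> X -> sub_measurable_mx <<s gen >> Y ->
  sub_measurable_mx <<s gen >> (fun w => X w + Y w).
Proof.
move=> mX mY i j; under eq_fun do rewrite mxE.
by apply/sub_measurableP/measurable_funD; exact/sub_measurableP.
Qed.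

Lemma sub_measurable_mx_mul p q r (X : Omega -> 'M[R]_(p, q))
    (Y : Omega -> 'M[R]_(q, r)) :
  sub_measurable_mx <<s gen >> X -> sub_measurable_mx <<s gen >> Y ->
  sub_measurable_mx <<s gen >> (fun w => X w *m Y w).
Proof.
move=> mX mY i j; under eq_fun do rewrite mxE.
apply/sub_measurableP/measurable_sum => k.
by apply: measurable_funM; exact/sub_measurableP.
Qed.

Lemma sub_measurable_mxZ p q (f : Omega -> R) (X : Omega -> 'M[R]_(p, q)) :
  sub_measurable <<s gen >> f -> sub_measurable_mx <<s gen >> X ->
  sub_measurable_mx <<s gen >> (fun w => f w *: X w).
Proof.
move=> mf mX i j; under eq_fun do rewrite mxE.
by apply/sub_measurableP/measurable_funM; exact/sub_measurableP.
Qed.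

Hypothesis gen_sub : <<s gen >> `<=` measurable.

(** The form is a sum of entries of X times adapted scalars, so the scalar rule applies to each
    summand. Integrability is asked entry by entry, since that of the whole form would not yield
    it. *)
Lemma pull_out_form n (X : Omega -> 'M[R]_n) (y z : Omega -> 'cV[R]_n) :
  (forall i j, rintegrable Pr (fun w => X w i j)) ->
  sub_measurable_mx <<s gen >> y -> sub_measurable_mx <<s gen >> z ->
  (forall i j, rintegrable Pr (fun w => (y w j 0 * z w i 0) * X w i j)) ->
  same_mean Pr (fun w => dotv (X w *m y w) (z w))
    (fun w => dotv (cond_exp_mx Pr <<s gen >> X w *m y w) (z w)).
Proof.
have E (M : 'M[R]_n) (u v : 'cV[R]_n) :
    dotv (M *m u) v = \sum_i \sum_j (u j 0 * v i 0) * M i j.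
  rewrite dotvE; apply: eq_bigr => i _; rewrite mxE mulr_suml.
  by apply: eq_bigr => j _; rewrite [RHS]mulrC mulrA.
move=> Xi my mz yzX; under eq_fun do rewrite E.
under [X in same_mean _ _ X]eq_fun do rewrite E.
apply: same_mean_sum => i; apply: same_mean_sum => j.
under [X in same_mean _ _ X]eq_fun do rewrite mxE.
apply: (pull_out gen_sub) => //; first exact: cond_expP.
by apply/sub_measurableP/measurable_funM; exact/sub_measurableP.
Qed.

Lemma pull_out_dotv n (X z : Omega -> 'cV[R]_n) :
  (forall i j, rintegrable Pr (fun w => X w i j)) ->
  sub_measurable_mx <<s gen >> z ->
  (forall i, rintegrable Pr (fun w => z w i 0 * X w i 0)) ->
  same_mean Pr (fun w => dotv (X w) (z w))
    (fun w => dotv (cond_exp_mx Pr <<s gen >> X w) (z w)).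
Proof.
move=> Xi mz zX; under eq_fun do rewrite dotvC dotvE.
under [X in same_mean _ _ X]eq_fun do rewrite dotvC dotvE.
apply: same_mean_sum => i.
under [X in same_mean _ _ X]eq_fun do rewrite mxE.
by apply: (pull_out gen_sub) => //; exact: cond_expP.
Qed.

(** Symmetry holds at every point, not just almost surely: the entries (i, j) and (j, i) agree
    almost surely, hence the choice operator selects one and the same version for both. *)
Lemma cond_exp_mx_sym n (X : Omega -> 'M[R]_n) :
  (forall i j, measurable_fun setT (fun w => X w i j)) ->
  (\forall w \ae Pr, symmx (X w)) ->
  forall w, symmx (cond_exp_mx Pr <<s gen >> X w).
Proof.
move=> mX sX w; apply/matrixP => i j; rewrite !mxE; congr (_ w).
apply: (cond_exp_ae_eq gen_sub) => //; apply: filterS sX => w' sX.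
by rewrite -[in RHS]sX mxE.
Qed.

End RandomMatrices.

(** * One time step of the linear-quadratic problem *)

Section LQStep.
Context (R : realType) (d : measure_display) (Omega : measurableType d).
Variable Pr : probability Omega R.
Hypothesis Pr_complete : measure_is_complete Pr.
Variable gen : set (set Omega).
Hypothesis gen_sub : <<s gen >> `<=` measurable.
Variable om : Omega -> R.
Hypothesis m_om : measurable_fun setT om.
Hypothesis om2 : is_cond_exp Pr <<s gen >> (fun w => om w ^+ 2) (cst 1).

Lemma sqintegrable_noise : sqintegrable Pr om.
Proof. by split=> //; case: om2. Qed.

(** A product of two square-integrable functions is in general only integrable; here E[omega^2 | F]
    = 1 makes omega^2 z^2 integrable as soon as z^2 is. *)
Lemma sqintegrable_noiseM (z : Omega -> R) :
  sub_measurable <<s gen >> z -> sqintegrable Pr z ->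
  sqintegrable Pr (fun w => om w * z w).
Proof.
move=> mz [mz' z2]; split; first exact: measurable_funM.
under eq_fun do rewrite exprMn mulrC.
apply: (ge0_rintegrable_pull_in gen_sub om2) => //.
- by move=> w; exact: sqr_ge0.
- by apply/sub_measurableP/measurable_funX; exact/sub_measurableP.
- by move=> w; exact: sqr_ge0.
- by under eq_fun do rewrite mulr1.
Qed.

Variables (n p : nat).

Definition moment q r (Y : Omega -> 'M[R]_(q, r)) (j : nat) : Omega -> 'M[R]_(q, r) :=
  cond_exp_mx Pr <<s gen >> (fun w => om w ^+ j *: Y w).

Definition quad (T : 'M[R]_n) (phi x : 'cV[R]_n) : R :=
  dotv (T *m x) x + 2 * dotv phi x.

Variables (T' : Omega -> 'M[R]_n) (phi' : Omega -> 'cV[R]_n).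
Hypotheses (T'_bd : bounded_mx Pr T') (T'_sym : \forall w \ae Pr, symmx (T' w)).
Hypothesis phi'_sq : sqintegrable_mx Pr phi'.

Local Notation t w := (moment T' ^~ w).
Local Notation f w := (moment phi' ^~ w).

(** Expanding in powers of the noise leaves terms to which the pull-out rule applies. The bounded
    [T'] carries powers up to 2, whereas [phi'], only square-integrable, carries powers up to 1. *)
Lemma same_mean_quad (y z : Omega -> 'cV[R]_n) :
  sub_measurable_mx <<s gen >> y -> sub_measurable_mx <<s gen >> z ->
  sqintegrable_mx Pr y -> sqintegrable_mx Pr z ->
  same_mean Pr (fun w => quad (T' w) (phi' w) (y w + om w *: z w))
    (fun w => moment_cost (t w) (f w) (y w) (z w)).
Proof.
move=> my mz y2 z2.
have E w : quad (T' w) (phi' w) (y w + om w *: z w) =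
    dotv ((om w ^+ 0 *: T' w) *m y w) (y w) +
    (dotv ((om w ^+ 1 *: T' w) *m y w) (z w) +
     dotv ((om w ^+ 1 *: T' w) *m z w) (y w)) +
    dotv ((om w ^+ 2 *: T' w) *m z w) (z w) +
    2 * dotv (om w ^+ 0 *: phi' w) (y w) + 2 * dotv (om w ^+ 1 *: phi' w) (z w).
  rewrite /quad -!scalemxAl !mulmxDr -!scalemxAr !dotvDl !dotvDr !dotvZl !dotvZr.
  by ring.
under eq_fun do rewrite E.
have oz i : sqintegrable Pr (fun w => om w * z w i 0) by exact: sqintegrable_noiseM.
have bT i j (h : Omega -> R) :
    rintegrable Pr h -> rintegrable Pr (fun w => T' w i j * h w).
  by move=> hi; have [mT [c Tc]] := T'_bd i j; exact: rintegrable_bM mT Tc hi.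
have T_int k i j : (k <= 2)%N -> rintegrable Pr (fun w => (om w ^+ k *: T' w) i j).
  move=> k2; under eq_fun do rewrite mxE mulrC; apply: bT.
  case: k k2 => [|[|[|]]]// _.
  - by under eq_fun do rewrite expr0; exact: rintegrable_cst.
  - by under eq_fun do rewrite expr1; exact/sqintegrable_rintegrable/sqintegrable_noise.
  - by case: sqintegrable_noise.
have phi_int k i j : (k <= 1)%N -> rintegrable Pr (fun w => (om w ^+ k *: phi' w) i j).
  move=> k1; under eq_fun do rewrite mxE.
  case: k k1 => [|[|]]// _.
  - by under eq_fun do rewrite expr0 mul1r; exact: sqintegrable_rintegrable.
  - by under eq_fun do rewrite expr1; exact/rintegrableM/phi'_sq/sqintegrable_noise.
have ext (g h : Omega -> R) : g =1 h -> rintegrable Pr h -> rintegrable Pr g.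
  by move=> /funext ->.
apply: same_meanD; last first.
  apply/same_meanZ/(pull_out_dotv gen_sub) => // [i j|i]; first exact: phi_int.
  apply: (ext _ (fun w => (om w * z w i 0) * phi' w i 0)); last exact: rintegrableM.
  by move=> w; rewrite mxE; ring.
apply: same_meanD; last first.
  apply/same_meanZ/(pull_out_dotv gen_sub) => // [i j|i]; first exact: phi_int.
  apply: (ext _ (fun w => y w i 0 * phi' w i 0)); last exact: rintegrableM.
  by move=> w; rewrite mxE; ring.
apply: same_meanD; last first.
  apply: (pull_out_form gen_sub) => // i j; first exact: T_int.
  (* One factor [om] goes to each component of [z], which exhibits a bounded entry times a product
     of two square-integrable functions. *)
  apply: (ext _ (fun w => T' w i j * ((om w * z w i 0) * (om w * z w j 0)))).
    by move=> w; rewrite mxE; ring.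
  exact/bT/rintegrableM.
apply: same_meanD.
  apply: (pull_out_form gen_sub) => // i j; first exact: T_int.
  apply: (ext _ (fun w => T' w i j * (y w i 0 * y w j 0))).
    by move=> w; rewrite mxE; ring.
  exact/bT/rintegrableM.
apply: same_meanD.
  apply: (pull_out_form gen_sub) => // i j; first exact: T_int.
  apply: (ext _ (fun w => T' w i j * ((om w * z w i 0) * y w j 0))).
    by move=> w; rewrite mxE; ring.
  exact/bT/rintegrableM.
apply: (pull_out_form gen_sub) => // i j; first exact: T_int.
apply: (ext _ (fun w => T' w i j * ((om w * z w j 0) * y w i 0))).
  by move=> w; rewrite mxE; ring.
exact/bT/rintegrableM.
Qed.

Lemma moment_sym w j : symmx (t w j).
Proof.
apply: (cond_exp_mx_sym gen_sub) => // [i k|].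
  under eq_fun do rewrite mxE; apply: measurable_funM; first exact: measurable_funX.
  by case: (T'_bd i k).
by apply: filterS T'_sym => w' sT; rewrite /symmx linearZ/= sT.
Qed.

Variables (A D : Omega -> 'M[R]_n) (B E : Omega -> 'M[R]_(n, p)).
Variables (a s : Omega -> 'cV[R]_n).
Variables (Q : Omega -> 'M[R]_n) (L : Omega -> 'M[R]_(p, n)) (S : Omega -> 'M[R]_p).
Variables (q : Omega -> 'cV[R]_n) (rho : Omega -> 'cV[R]_p).
Hypotheses (A_bd : bounded_mx Pr A) (D_bd : bounded_mx Pr D).
Hypotheses (B_bd : bounded_mx Pr B) (E_bd : bounded_mx Pr E).
Hypotheses (Q_bd : bounded_mx Pr Q) (L_bd : bounded_mx Pr L) (S_bd : bounded_mx Pr S).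
Hypotheses (a_sq : sqintegrable_mx Pr a) (s_sq : sqintegrable_mx Pr s).
Hypotheses (q_sq : sqintegrable_mx Pr q) (rho_sq : sqintegrable_mx Pr rho).
Hypotheses (mA : sub_measurable_mx <<s gen >> A) (mD : sub_measurable_mx <<s gen >> D).
Hypotheses (mB : sub_measurable_mx <<s gen >> B) (mE : sub_measurable_mx <<s gen >> E).
Hypotheses (ma : sub_measurable_mx <<s gen >> a) (ms : sub_measurable_mx <<s gen >> s).

Variables (T : Omega -> 'M[R]_n) (phi : Omega -> 'cV[R]_n).
Hypotheses (T_bd : bounded_mx Pr T) (phi_sq : sqintegrable_mx Pr phi).

Let Ups w := lq_Upsilon (B w) (E w) (S w) (t w).
Let Lam w := lq_Lambda (A w) (D w) (B w) (E w) (L w) (t w).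
Let Phi w := lq_Phi (B w) (E w) (a w) (s w) (rho w) (t w) (f w).
Let Del w := lq_Delta (A w) (D w) (Q w) (t w).
Let The w := lq_Theta (A w) (D w) (a w) (s w) (q w) (t w) (f w).

Hypothesis Ups_sym : \forall w \ae Pr, symmx (Ups w).
Hypothesis Ups_unit : \forall w \ae Pr, Ups w \in unitmx.
Hypothesis T_eq : \forall w \ae Pr, T w = Del w - (Lam w)^T *m invmx (Ups w) *m Lam w.
Hypothesis phi_eq : \forall w \ae Pr,
  phi w = The w - (Lam w)^T *m invmx (Ups w) *m Phi w.

Let y x u (w : Omega) : 'cV[R]_n := A w *m x w + B w *m u w + a w.
Let z x u (w : Omega) : 'cV[R]_n := D w *m x w + E w *m u w + s w.
Let dev x u (w : Omega) : 'cV[R]_p := u w + invmx (Ups w) *m (Lam w *m x w + Phi w).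
Let stage x u w := stage_cost (Q w) (L w) (S w) (q w) (rho w) (x w) (u w).

Lemma rintegrable_stage x u : sqintegrable_mx Pr x -> sqintegrable_mx Pr u ->
  rintegrable Pr (stage x u).
Proof.
move=> x2 u2.
apply: rintegrableD; last exact/rintegrableZ/rintegrable_dotv.
apply: rintegrableD; last exact/rintegrableZ/rintegrable_dotv.
apply: rintegrableD; last exact: rintegrable_form.
apply: rintegrableD; first exact: rintegrable_form.
by apply/rintegrableZ/rintegrable_form => //; exact: bounded_mx_tr.
Qed.

Lemma rintegrable_quad x : sqintegrable_mx Pr x ->
  rintegrable Pr (fun w => quad (T w) (phi w) (x w)).
Proof.
move=> x2; apply: rintegrableD; first exact: rintegrable_form.
exact/rintegrableZ/rintegrable_dotv.
Qed.

(** The deviation term and the term in [Phi] are kept together as [rem]: at this point only their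
    difference is known to be integrable. *)
Lemma same_mean_step_raw x u :
  sub_measurable_mx <<s gen >> x -> sub_measurable_mx <<s gen >> u ->
  sqintegrable_mx Pr x -> sqintegrable_mx Pr u ->
  let rem w := dotv (Ups w *m dev x u w) (dev x u w)
               - dotv (Phi w) (invmx (Ups w) *m Phi w) in
  rintegrable Pr rem /\
  same_mean Pr
    (fun w => stage x u w + quad (T' w) (phi' w) (y x u w + om w *: z x u w))
    (fun w => quad (T w) (phi w) (x w) + rem w
              + quad (T' w) (phi' w) (a w + om w *: s w)).
Proof.
move=> mx mu x2 u2 rem.
have my : sub_measurable_mx <<s gen >> (y x u).
  by do 2 (apply: sub_measurable_mxD => //); exact: sub_measurable_mx_mul.
have mz : sub_measurable_mx <<s gen >> (z x u).
  by do 2 (apply: sub_measurable_mxD => //); exact: sub_measurable_mx_mul.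
have y2 : sqintegrable_mx Pr (y x u).
  by do 2 (apply: sqintegrable_mxD => //); exact: sqintegrable_mx_mul.
have z2 : sqintegrable_mx Pr (z x u).
  by do 2 (apply: sqintegrable_mxD => //); exact: sqintegrable_mx_mul.
have st := rintegrable_stage x2 u2.
have V := rintegrable_quad x2.
have Hyz := same_mean_quad my mz y2 z2.
have Has := same_mean_quad ma ms a_sq s_sq.
(* The step identity solved for the remainder: a combination of integrable functions, almost surely
   equal to [rem] by completion of the square. *)
pose rem' w := (stage x u w + moment_cost (t w) (f w) (y x u w) (z x u w))
  - moment_cost (t w) (f w) (a w) (s w) - quad (T w) (phi w) (x w).
have rem'i : rintegrable Pr rem'.
  apply: rintegrableB => //; apply: rintegrableB; last by case: Has.
  by apply: rintegrableD => //; case: Hyz.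
have remE : \forall w \ae Pr, rem' w = rem w.
  apply: filterS2 (filterI Ups_sym Ups_unit) (filterI T_eq phi_eq) => w [sU uU] [eT ep].
  rewrite /rem' /stage stage_moment_cost; last exact: moment_sym.
  rewrite addrK (complete_square _ _ sU uU eT ep) addrC addrA /quad.
  by rewrite [X in X + _]addrC subrr add0r.
have remi : rintegrable Pr rem by exact: (rintegrable_complete Pr_complete) remE rem'i.
split=> //.
have stE : (fun w => stage x u w + moment_cost (t w) (f w) (y x u w) (z x u w)) =
    (fun w => quad (T w) (phi w) (x w) + rem' w + moment_cost (t w) (f w) (a w) (s w)).
  by apply/funext => w; rewrite /rem'; ring.
apply: same_mean_trans (same_meanD (same_mean_refl st) Hyz) _.
(* [Has] is read backwards: the moments at [a], [s] become again the quadratic function of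
   [a + om s], so that the constant involves T_{k+1}, phi_{k+1} and beta_k themselves. *)
rewrite stE; apply/same_meanD/same_mean_sym/Has.
apply: same_meanD; first exact: same_mean_refl.
by apply: same_mean_ae_eq => //; exact: rintegrable_measurable remi.
Qed.

Variable Sig : Omega -> 'cV[R]_p.
Hypotheses (Sig_sq : sqintegrable_mx Pr Sig) (mSig : sub_measurable_mx <<s gen >> Sig).
Hypothesis Sig_eq : \forall w \ae Pr, Sig w = - (invmx (Ups w) *m Phi w).

(* At the zero state, the control [Sig] has no deviation: what remains of the
   step identity is the integrability of the quadratic term in [Phi]. *)
Lemma rintegrable_Phi :
  rintegrable Pr (fun w => dotv (Phi w) (invmx (Ups w) *m Phi w)).
Proof.
have m0 : sub_measurable_mx <<s gen >> (fun=> 0 : 'cV[R]_n).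
  by move=> i j; apply/sub_measurableP; exact: measurable_cst.
have s0 : sqintegrable_mx Pr (fun=> 0 : 'cV[R]_n).
  move=> i j; exact: sqintegrable_cst.
have [ri _] := same_mean_step_raw m0 mSig s0 Sig_sq.
apply: (rintegrable_complete Pr_complete) (rintegrableZ (-1) ri).
apply: filterS Sig_eq => w Sw /=.
rewrite /dev Sw mulmx0 add0r addNr dotv0r; ring.
Qed.

(** Adding the now integrable term in [Phi] back to the remainder of an arbitrary control isolates
    its deviation term, which becomes integrable in turn. *)
Lemma same_mean_step x u :
  sub_measurable_mx <<s gen >> x -> sub_measurable_mx <<s gen >> u ->
  sqintegrable_mx Pr x -> sqintegrable_mx Pr u ->
  [/\ rintegrable Pr (stage x u),
      rintegrable Pr (fun w => dotv (Ups w *m dev x u w) (dev x u w)),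
      rintegrable Pr (fun w => 2 * dotv (phi' w) (a w + om w *: s w)
        - dotv (Phi w) (invmx (Ups w) *m Phi w)
        + dotv (T' w *m (a w + om w *: s w)) (a w + om w *: s w)) &
      same_mean Pr
        (fun w => stage x u w + quad (T' w) (phi' w) (y x u w + om w *: z x u w))
        (fun w => quad (T w) (phi w) (x w)
          + (dotv (Ups w *m dev x u w) (dev x u w)
             + (2 * dotv (phi' w) (a w + om w *: s w)
                - dotv (Phi w) (invmx (Ups w) *m Phi w)
                + dotv (T' w *m (a w + om w *: s w)) (a w + om w *: s w))))].
Proof.
move=> mx mu x2 u2.
have [ri st] := same_mean_step_raw mx mu x2 u2.
have Pi := rintegrable_Phi.
have [qi _ _] := same_mean_quad ma ms a_sq s_sq.
have ext (g h : Omega -> R) : g =1 h -> rintegrable Pr h -> rintegrable Pr g.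
  by move=> /funext ->.
split.
- exact: rintegrable_stage.
- by apply: (ext _ _ _ (rintegrableD ri Pi)) => w; rewrite subrK.
- by apply: (ext _ _ _ (rintegrableB qi Pi)) => w; rewrite /quad; ring.
- rewrite (_ : (fun w => quad (T w) (phi w) (x w) + _) =
    (fun w => quad (T w) (phi w) (x w) + (dotv (Ups w *m dev x u w) (dev x u w)
               - dotv (Phi w) (invmx (Ups w) *m Phi w))
              + quad (T' w) (phi' w) (a w + om w *: s w)))//.
  by apply/funext => w; rewrite /quad; ring.
Qed.

End LQStep.

(** * The noise filtration and the process spaces *)

Section Filtration.
Context (R : realType) (d : measure_display) (Omega : measurableType d).
Variables (Pr : probability Omega R) (n m l N : nat) (g : lq_game R Omega n m l).
Hypothesis Hnoise : noise_assumption Pr g N.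

(** Names the generators, so that [filt g k] is convertible to [<<s gen k>>], the shape expected by
    the results on conditional expectations. *)
Let gen k := \bigcup_(i in [set i | (i < k)%N])
  preimage_set_system setT (noise g i) measurable.

Lemma filt_measurable k : (k <= N)%N -> filt g k `<=` measurable.
Proof.
move=> kN; apply: smallest_sub; first exact: sigma_algebra_measurable.
move=> _ [i /= ik [B mB <-]].
by have [mi _ _] := Hnoise (leq_trans ik kN); exact: mi.
Qed.

Lemma filtS k : filt g k `<=` filt g k.+1.
Proof.
apply: sub_sigma_algebra2 => A [i /= ik iA]; exists i => //=.
exact: ltnW.
Qed.

Lemma noise_filt k : sub_measurable (filt g k.+1) (noise g k).
Proof.
move=> B mB; apply: sub_gen_smallest; exists k; first exact: ltnSn.
by exists B => //; rewrite setTI.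
Qed.

Lemma sub_measurable_mx_filtS p q (X : Omega -> 'M[R]_(p, q)) k :
  sub_measurable_mx (filt g k) X -> sub_measurable_mx (filt g k.+1) X.
Proof. by move=> mX i j B mB; apply: filtS; exact: mX. Qed.

Lemma filt_measurable_mx p q (X : Omega -> 'M[R]_(p, q)) k : (k <= N)%N ->
  sub_measurable_mx (filt g k) X ->
  forall i j, measurable_fun setT (fun w => X w i j).
Proof.
move=> kN mX i j.
exact: (sub_measurable_measurable (gen := gen k)) (filt_measurable kN) _ (mX i j).
Qed.

Lemma LinfF_bounded K p q (X : nat -> Omega -> 'M[R]_(p, q)) : (K <= N.+1)%N ->
  LinfF Pr g K X -> forall k, (k < K)%N -> bounded_mx Pr (X k).
Proof.
move=> KN [mX [c Xc]] k kK i j; split.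
  apply: (filt_measurable_mx _ (mX k kK)).
  by rewrite -ltnS (leq_trans kK).
by exists c; apply: filterS (Xc k kK) => w; apply: le_trans; exact: enorm_entry.
Qed.

(** The sum over all times dominates each of its terms; its own measurability has to be shown first,
    because a finite expectation does not include it. *)
Lemma L2F_sqintegrable K p (X : nat -> Omega -> 'cV[R]_p) : (K <= N.+1)%N ->
  L2F Pr g K X -> forall k, (k < K)%N -> sqintegrable_mx Pr (X k).
Proof.
move=> KN [mX X2] k kK.
have mX' j : (j < K)%N -> forall i i', measurable_fun setT (fun w => X j w i i').
  move=> jK; apply: (filt_measurable_mx _ (mX j jK)).
  by rewrite -ltnS (leq_trans jK).
apply: sqintegrable_mx_le X2; first exact: mX'.
- apply: measurable_sum => j; under eq_fun do rewrite enorm_sqr.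
  apply: measurable_sum => i; apply: measurable_sum => i'.
  exact/measurable_funX/mX'.
- move=> w; rewrite (bigD1 (Ordinal kK))//= lerDl.
  by apply: sumr_ge0 => j _; exact: sqr_ge0.
Qed.

Lemma sqintegrable_L2F K p (X : nat -> Omega -> 'cV[R]_p) :
  (forall k, (k < K)%N -> sub_measurable_mx (filt g k) (X k)) ->
  (forall k, (k < K)%N -> sqintegrable_mx Pr (X k)) -> L2F Pr g K X.
Proof.
move=> mX X2; split => //; rewrite expectation_Rintegral ?ltry//.
apply: rintegrable_sum => k; exact/rintegrable_enorm/X2.
Qed.

End Filtration.

(** * Closed-loop trajectories *)

Section ClosedLoop.
Context (R : realType) (d : measure_display) (Omega : measurableType d).
Variables (Pr : probability Omega R) (n m l N : nat) (g : lq_game R Omega n m l).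

(** The costs run the open-loop recursion [state] on feedback controls; this identifies the result
    with the closed-loop trajectory that produced them. *)
Lemma state_cl_state xi Pi1 Sig1 Pi2 Sig2 :
  state g xi (feedback Pi1 Sig1 (cl_state g Pi1 Sig1 Pi2 Sig2 xi))
    (feedback Pi2 Sig2 (cl_state g Pi1 Sig1 Pi2 Sig2 xi))
  = cl_state g Pi1 Sig1 Pi2 Sig2 xi.
Proof.
apply/funext => k; apply/funext => w.
by elim: k => [//|k IH] /=; rewrite IH.
Qed.

(** The dynamics as seen by player 1: the linear part of the opponent's feedback enters the state
    coefficients and its affine part enters the inhomogeneous terms. *)
Lemma cl_stateS xi Pi1 Sig1 Pi2 Sig2 k w :
  let x := cl_state g Pi1 Sig1 Pi2 Sig2 xi in
  let u := feedback Pi1 Sig1 x in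
  x k.+1 w =
    (Ahat g Pi2 k w *m x k w + cB g k w *m u k w
     + (cC g k w *m Sig2 k w + cb g k w))
    + noise g k w *: (Dhat g Pi2 k w *m x k w + cE g k w *m u k w
                      + (cF g k w *m Sig2 k w + csigma g k w)).
Proof.
move=> x u; rewrite /Ahat /Dhat.
have E p q r (A : 'M[R]_(p, q)) (C : 'M[R]_(p, r)) (P : 'M[R]_(r, q)) y s (b c : 'cV_p) :
    A *m y + b + C *m (P *m y + s) + c = (A + C *m P) *m y + b + (C *m s + c).
  rewrite mulmxDr mulmxDl !mulmxA !addrA; congr (_ + _); congr (_ + _).
  by rewrite addrAC.
by rewrite -!E.
Qed.

Hypotheses (Hnoise : noise_assumption Pr g N) (H1 : assumption1 Pr g N).
Variables (Pi1 : nat -> Omega -> 'M[R]_(m, n)) (Sig1 : nat -> Omega -> 'cV[R]_m).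
Variables (Pi2 : nat -> Omega -> 'M[R]_(l, n)) (Sig2 : nat -> Omega -> 'cV[R]_l).
Hypotheses (s1 : strategy Pr g N Pi1 Sig1) (s2 : strategy Pr g N Pi2 Sig2).
Variable xi : 'cV[R]_n.

Let gen k := \bigcup_(i in [set i | (i < k)%N])
  preimage_set_system setT (noise g i) measurable.

Local Notation x := (cl_state g Pi1 Sig1 Pi2 Sig2 xi).

Lemma feedback_adapted p (Pi : nat -> Omega -> 'M[R]_(p, n)) Sig y k :
  strategy Pr g N Pi Sig -> (k < N)%N ->
  sub_measurable_mx (filt g k) (y k) -> sqintegrable_mx Pr (y k) ->
  sub_measurable_mx (filt g k) (feedback Pi Sig y k) /\
  sqintegrable_mx Pr (feedback Pi Sig y k).
Proof.
move=> [Pib Sig2L] kN my y2; split.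
  apply: (sub_measurable_mxD (gen := gen k)); last by case: Sig2L => + _; apply.
  by apply: (sub_measurable_mx_mul (gen := gen k)) => //; case: Pib => + _; apply.
apply: sqintegrable_mxD; last exact: (L2F_sqintegrable Hnoise (leqnSn N)) kN.
apply: sqintegrable_mx_mul => //.
exact: (LinfF_bounded Hnoise (leqnSn N)) kN.
Qed.

(** Boundedness of coefficients and gains preserves square-integrability at each step, and the noise
    term is covered by the conditional second moment. Both strategies are arbitrary, so unilateral
    deviations are included. *)
Lemma cl_state_adapted k : (k <= N)%N ->
  sub_measurable_mx (filt g k) (x k) /\ sqintegrable_mx Pr (x k).
Proof.
elim: k => [_|k IH kN].
  split=> i j; last exact: sqintegrable_cst.
  by apply/(sub_measurableP (gen 0%N)); exact: measurable_cst.
have [mx x2] := IH (ltnW kN).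
have [mu u2] := feedback_adapted s1 kN mx x2.
have [mv v2] := feedback_adapted s2 kN mx x2.
have [[[mA _] [mB _] [mC _]] [[mD _] [mE _] [mF _]] [mb _] [ms _]] := H1.
have [[Ab Bb Cb] [Db Eb Fb] b2 sg2] := H1.
have bd p q (X : nat -> Omega -> 'M[R]_(p, q)) : LinfF Pr g N X -> bounded_mx Pr (X k).
  by move=> XL; exact: (LinfF_bounded Hnoise (leqnSn N)) kN.
have sq p (X : nat -> Omega -> 'cV[R]_p) : L2F Pr g N X -> sqintegrable_mx Pr (X k).
  by move=> XL; exact: (L2F_sqintegrable Hnoise (leqnSn N)) kN.
have md : sub_measurable_mx (filt g k) (fun w => cA g k w *m x k w
    + cB g k w *m feedback Pi1 Sig1 x k w
    + cC g k w *m feedback Pi2 Sig2 x k w + cb g k w).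
  do ! apply: (sub_measurable_mxD (gen := gen k)); last exact: mb.
  - by apply: (sub_measurable_mx_mul (gen := gen k)) => //; exact: mA.
  - by apply: (sub_measurable_mx_mul (gen := gen k)) => //; exact: mB.
  - by apply: (sub_measurable_mx_mul (gen := gen k)) => //; exact: mC.
have mz : sub_measurable_mx (filt g k) (fun w => cD g k w *m x k w
    + cE g k w *m feedback Pi1 Sig1 x k w
    + cF g k w *m feedback Pi2 Sig2 x k w + csigma g k w).
  do ! apply: (sub_measurable_mxD (gen := gen k)); last exact: ms.
  - by apply: (sub_measurable_mx_mul (gen := gen k)) => //; exact: mD.
  - by apply: (sub_measurable_mx_mul (gen := gen k)) => //; exact: mE.
  - by apply: (sub_measurable_mx_mul (gen := gen k)) => //; exact: mF.
have [mo _ o2] := Hnoise kN.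
split.
  apply: (sub_measurable_mxD (gen := gen k.+1)); first exact: sub_measurable_mx_filtS.
  apply: (sub_measurable_mxZ (gen := gen k.+1)); first exact: noise_filt.
  exact: sub_measurable_mx_filtS.
apply: sqintegrable_mxD.
  apply: sqintegrable_mxD (sq _ _ b2); do ! apply: sqintegrable_mxD.
  - exact: sqintegrable_mx_mul (bd _ _ _ Ab) x2.
  - exact: sqintegrable_mx_mul (bd _ _ _ Bb) u2.
  - exact: sqintegrable_mx_mul (bd _ _ _ Cb) v2.
have z2 : sqintegrable_mx Pr (fun w => cD g k w *m x k w
    + cE g k w *m feedback Pi1 Sig1 x k w
    + cF g k w *m feedback Pi2 Sig2 x k w + csigma g k w).
  apply: sqintegrable_mxD (sq _ _ sg2); do ! apply: sqintegrable_mxD.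
  - exact: sqintegrable_mx_mul (bd _ _ _ Db) x2.
  - exact: sqintegrable_mx_mul (bd _ _ _ Eb) u2.
  - exact: sqintegrable_mx_mul (bd _ _ _ Fb) v2.
move=> i j; under eq_fun do rewrite mxE.
apply: (sqintegrable_noiseM (gen := gen k)) (mz i j) (z2 i j) => //.
exact: (filt_measurable Hnoise (ltnW kN)).
Qed.

End ClosedLoop.

(** * Optimality of player 1's strategy against a fixed opponent *)

Section PlayerOne.
Context (R : realType) (d : measure_display) (Omega : measurableType d).
Variables (Pr : probability Omega R) (n m l N : nat) (g : lq_game R Omega n m l).
Hypothesis Pr_complete : measure_is_complete Pr.
Hypotheses (Hnoise : noise_assumption Pr g N) (H1 : assumption1 Pr g N).
Hypotheses (HQ : LinfF Pr g N (cQ g)) (HL : LinfF Pr g N (cL g)).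
Hypotheses (HR : LinfF Pr g N (cR g)).
Hypotheses (Hq : L2F Pr g N (cq g)) (Hrho : L2F Pr g N (crho g)).
Variables (T : nat -> Omega -> 'M[R]_n) (phi : nat -> Omega -> 'cV[R]_n).
Variables (Pi1 : nat -> Omega -> 'M[R]_(m, n)) (Sig1 : nat -> Omega -> 'cV[R]_m).
Variables (Pi2 : nat -> Omega -> 'M[R]_(l, n)) (Sig2 : nat -> Omega -> 'cV[R]_l).
Hypotheses (s1 : strategy Pr g N Pi1 Sig1) (s2 : strategy Pr g N Pi2 Sig2).
Hypotheses (T_Linf : LinfF_psd Pr g N T) (phi_L2 : L2F Pr g N.+1 phi).
Hypothesis Hriccati : riccati1 Pr g N T Pi1 Pi2.
Hypothesis Hbsde : bsde1 Pr g N T Pi2 phi Sig1 Sig2.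
Hypothesis Hregular : exists2 delta : R, 0 < delta &
  forall k, (k < N)%N -> \forall w \ae Pr, pdmx (Upsilon1 Pr g T k w - delta%:M).
Variable xi : 'cV[R]_n.

Let gen k := \bigcup_(i in [set i | (i < k)%N])
  preimage_set_system setT (noise g i) measurable.

Let bd p q (X : nat -> Omega -> 'M[R]_(p, q)) k : LinfF Pr g N X -> (k < N)%N ->
  bounded_mx Pr (X k).
Proof. by move=> XL kN; exact: (LinfF_bounded Hnoise (leqnSn N)) kN. Qed.

Let sq p (X : nat -> Omega -> 'cV[R]_p) k : L2F Pr g N X -> (k < N)%N ->
  sqintegrable_mx Pr (X k).
Proof. by move=> XL kN; exact: (L2F_sqintegrable Hnoise (leqnSn N)) kN. Qed.

Definition deviation x u k w : 'cV[R]_m := u k w +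
  invmx (Upsilon1 Pr g T k w) *m
    (Lambda1 Pr g T Pi2 k w *m x k w + Phi1 Pr g T Sig2 phi k w).

Definition offset k w := 2 * dotv (phi k.+1 w) (beta1 g Sig2 k w)
  - dotv (Phi1 Pr g T Sig2 phi k w)
      (invmx (Upsilon1 Pr g T k w) *m Phi1 Pr g T Sig2 phi k w)
  + dotv (T k.+1 w *m beta1 g Sig2 k w) (beta1 g Sig2 k w).

Let stage x u k w := stage_cost (cQ g k w) (cL g k w) (cR g k w) (cq g k w)
  (crho g k w) (x k w) (u k w).

(** The process [x] and the control [u] are arbitrary at time k, so that any competing strategy can
    be inserted; the candidate [Sig1] is what certifies the integrability of the term in [Phi1]. *)
Lemma player1_step (x : nat -> Omega -> 'cV[R]_n) (u : nat -> Omega -> 'cV[R]_m) k :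
  (k < N)%N ->
  sub_measurable_mx (filt g k) (x k) -> sqintegrable_mx Pr (x k) ->
  sub_measurable_mx (filt g k) (u k) -> sqintegrable_mx Pr (u k) ->
  [/\ rintegrable Pr (stage x u k),
      rintegrable Pr (fun w => dotv (Upsilon1 Pr g T k w *m deviation x u k w) (deviation x u k w)),
      rintegrable Pr (offset k) &
      same_mean Pr
        (fun w => stage x u k w + quad (T k.+1 w) (phi k.+1 w)
          (Ahat g Pi2 k w *m x k w + cB g k w *m u k w
            + (cC g k w *m Sig2 k w + cb g k w)
           + noise g k w *: (Dhat g Pi2 k w *m x k w + cE g k w *m u k w
                      + (cF g k w *m Sig2 k w + csigma g k w))))
        (fun w => quad (T k w) (phi k w) (x k w)
          + (dotv (Upsilon1 Pr g T k w *m deviation x u k w) (deviation x u k w) + offset k w))].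
Proof.
move=> kN mx x2 mu u2.
have [mo _ o2] := Hnoise kN.
have [[[mA _] [mB _] [mC _]] [[mD _] [mE _] [mF _]] [mb _] [ms _]] := H1.
have [[Ab Bb Cb] [Db Eb Fb] b2 sg2] := H1.
have [[mPi1 _] [mSig1 _]] := s1; have [Pi1b Sig1L] := s1.
have [[mPi2 _] [mSig2 _]] := s2; have [Pi2b Sig2L] := s2.
have [TL Tpsd] := T_Linf.
have Tb j : (j <= N)%N -> bounded_mx Pr (T j).
  by move=> jN; exact: (LinfF_bounded Hnoise (leqnn N.+1)).
have phib j : (j <= N)%N -> sqintegrable_mx Pr (phi j).
  by move=> jN; exact: (L2F_sqintegrable Hnoise (leqnn N.+1)).
have [delta d0 /(_ k kN) reg] := Hregular.
have [/(_ k kN) ric _] := Hriccati.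
have [/(_ k kN) bs _] := Hbsde.
have mM p q r (X : nat -> Omega -> 'M[R]_(p, q)) (Y : nat -> Omega -> 'M[R]_(q, r)) :
  sub_measurable_mx (filt g k) (X k) -> sub_measurable_mx (filt g k) (Y k) ->
  sub_measurable_mx (filt g k) (fun w => X k w *m Y k w).
  exact: (sub_measurable_mx_mul (gen := gen k)).
have mP p q (X Y : Omega -> 'M[R]_(p, q)) :
  sub_measurable_mx (filt g k) X -> sub_measurable_mx (filt g k) Y ->
  sub_measurable_mx (filt g k) (fun w => X w + Y w).
  exact: (sub_measurable_mxD (gen := gen k)).
apply: (@same_mean_step _ _ _ Pr Pr_complete (gen k) (filt_measurable Hnoise (ltnW kN))
  (noise g k) mo o2 n m (T k.+1) (phi k.+1) _ _ _ (Ahat g Pi2 k) (Dhat g Pi2 k)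
  (cB g k) (cE g k) (fun w => cC g k w *m Sig2 k w + cb g k w)
  (fun w => cF g k w *m Sig2 k w + csigma g k w) (cQ g k) (cL g k) (cR g k) (cq g k)
  (crho g k) _ _ _ _ _ _ _ _ _ _ _ _ _ _ _ _ _ (T k) (phi k) _ _ _ _ _ _ (Sig1 k)
  _ _ _ (x k) (u k)) => //.
- exact: Tb.
- by apply: filterS (Tpsd _ kN) => w [].
- exact: phib.
- by apply: bounded_mxD; [exact: bd|apply: bounded_mx_mul; exact: bd].
- by apply: bounded_mxD; [exact: bd|apply: bounded_mx_mul; exact: bd].
- exact: bd.
- exact: bd.
- exact: bd.
- exact: bd.
- exact: bd.
- apply: sqintegrable_mxD; last exact: sq.
  by apply: sqintegrable_mx_mul; [exact: bd|exact: sq].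
- apply: sqintegrable_mxD; last exact: sq.
  by apply: sqintegrable_mx_mul; [exact: bd|exact: sq].
- exact: sq.
- exact: sq.
- by apply: mP; [exact: mA|apply: mM; [exact: mC|exact: mPi2]].
- by apply: mP; [exact: mD|apply: mM; [exact: mF|exact: mPi2]].
- exact: mB.
- exact: mE.
- by apply: mP; [apply: mM; [exact: mC|exact: mSig2]|exact: mb].
- by apply: mP; [apply: mM; [exact: mF|exact: mSig2]|exact: ms].
- exact/Tb/ltnW.
- exact/phib/ltnW.
- by apply: filterS reg => w; exact: regular_symmx.
- by apply: filterS reg => w; exact: regular_unitmx.
- by apply: filterS ric => w [].
- by apply: filterS bs => w [].
- exact: sq.
- exact: mSig1.
- by apply: filterS bs => w [].
Qed.

Definition optimal_value w := dotv (phi 0%N w) xi + dotv (T 0%N w *m xi + phi 0%N w) xi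
  + \sum_(k < N) offset k w.

(** The lower bound does not depend on the strategy. Used at the candidate it yields the value, used
    at a competitor it yields the Nash inequality. *)
Lemma player1_verification Pi1' Sig1' : strategy Pr g N Pi1' Sig1' ->
  let x := cl_state g Pi1' Sig1' Pi2 Sig2 xi in
  let u := feedback Pi1' Sig1' x in
  let v := feedback Pi2 Sig2 x in
  ((2^-1)%:E * 'E_Pr[optimal_value] <= J1 Pr g N xi u v)%E /\
  ((forall k, (k < N)%N -> \forall w \ae Pr, deviation x u k w = 0) ->
   (J1 Pr g N xi u v = (2^-1)%:E * 'E_Pr[optimal_value])%E).
Proof.
move=> s1' x u v.
have adm k : (k <= N)%N -> _ := fun kN => cl_state_adapted Hnoise H1 s1' s2 xi kN.
pose V k w := quad (T k w) (phi k w) (x k w).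
pose pen k w := dotv (Upsilon1 Pr g T k w *m deviation x u k w) (deviation x u k w).
(* The two leading terms of the value formula are <T_0 xi, xi> + 2 <phi_0, xi>, that is V_0 at the
   initial state. *)
have valE : optimal_value = (fun w => V 0%N w + \sum_(k < N) offset k w).
  by apply/funext => w; rewrite /optimal_value /V /quad dotvDl; ring.
rewrite /J1 state_cl_state -/x -/u -/v.
set cost := (X in (_ <= _ * 'E_Pr[X])%E); rewrite valE.
have [TL _] := T_Linf.
have V0 : rintegrable Pr (V 0%N).
  apply: rintegrable_quad.
  - exact: (LinfF_bounded Hnoise (leqnn N.+1) TL (ltn0Sn N)).
  - exact: (L2F_sqintegrable Hnoise (leqnn N.+1) phi_L2 (ltn0Sn N)).
  - by move=> i j; exact: sqintegrable_cst.
have costE : \forall w \ae Pr, cost w = V N w + \sum_(k < N) stage x u k w.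
  have [_ TN] := Hriccati; have [_ phiN] := Hbsde.
  by apply: filterS2 TN phiN => w TN phiN; rewrite /cost /V /quad TN phiN.
have step k : (k < N)%N -> [/\ rintegrable Pr (stage x u k), rintegrable Pr (pen k),
    rintegrable Pr (offset k) & same_mean Pr (fun w => stage x u k w + V k.+1 w)
      (fun w => V k w + (pen k w + offset k w))].
  move=> kN; have [mx x2] := adm k (ltnW kN).
  have [mu u2] := feedback_adapted Hnoise s1' kN mx x2.
  have [st de re sm] := player1_step kN mx x2 mu u2.
  split; [exact: st|exact: de|exact: re|].
  have xS w : x k.+1 w = _ := cl_stateS g xi Pi1' Sig1' Pi2 Sig2 k w.
  by rewrite /V; under eq_fun do rewrite xS; exact: sm.
have pen0 k : (k < N)%N -> \forall w \ae Pr, 0 <= pen k w.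
  move=> kN; have [delta d0 /(_ k kN)] := Hregular.
  by apply: filterS => w; exact: regular_ge0.
have [le eq] := verification Pr_complete V0 costE step pen0.
split; first by rewrite lee_pmul2l// lte_fin invr_gt0.
move=> dev0; congr (_ * _)%E; apply: eq => k kN.
by apply: filterS (dev0 k kN) => w dw; rewrite /pen dw dotv0r.
Qed.

Lemma feedback_deviation_eq0 (x : nat -> Omega -> 'cV[R]_n) k : (k < N)%N ->
  \forall w \ae Pr, deviation x (feedback Pi1 Sig1 x) k w = 0.
Proof.
move=> kN; have [/(_ k kN) ric _] := Hriccati; have [/(_ k kN) bs _] := Hbsde.
apply: filterS2 ric bs => w [_ ric] [_ bs].
rewrite /deviation /feedback ric bs; move: (invmx _) (Lambda1 _ _ _ _ _ _) (Phi1 _ _ _ _ _ _ _).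
by move=> U Lam Phi; rewrite mulmxDr mulNmx mulmxA -opprD addNr.
Qed.

End PlayerOne.

(** * Exchange of the players *)

Definition swap_game (R : realType) (Omega : Type) (n m l : nat)
    (g : lq_game R Omega n m l) : lq_game R Omega n l m :=
  LQGame (noise g) (cA g) (cC g) (cB g) (cb g) (cD g) (cF g) (cE g) (csigma g)
    (cP g) (cM g) (cS g) (cp g) (ctheta g) (cHN g) (chN g)
    (cQ g) (cL g) (cR g) (cq g) (crho g) (cGN g) (cgN g).

Section Swap.
Context (R : realType) (d : measure_display) (Omega : measurableType d).
Variables (Pr : probability Omega R) (n m l N : nat) (g : lq_game R Omega n m l).

Lemma state_swap xi u v : state (swap_game g) xi v u = state g xi u v.
Proof.
apply/funext => k; apply/funext => w; elim: k => [//|k IH] /=.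
by rewrite IH [_ + cC g k w *m _ + _]addrAC [_ + cF g k w *m _ + _]addrAC.
Qed.

Lemma cl_state_swap Pi1 Sig1 Pi2 Sig2 xi :
  cl_state (swap_game g) Pi2 Sig2 Pi1 Sig1 xi = cl_state g Pi1 Sig1 Pi2 Sig2 xi.
Proof.
apply/funext => k; apply/funext => w; elim: k => [//|k IH] /=.
by rewrite IH [_ + cC g k w *m _ + _]addrAC [_ + cF g k w *m _ + _]addrAC.
Qed.

Lemma J1_swap xi u v : J1 Pr (swap_game g) N xi v u = J2 Pr g N xi u v.
Proof. by rewrite /J1 state_swap. Qed.

Lemma J2_feedback_swap Pi1 Sig1 Pi2 Sig2 xi :
  let x := cl_state g Pi1 Sig1 Pi2 Sig2 xi in
  let y := cl_state (swap_game g) Pi2 Sig2 Pi1 Sig1 xi in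
  J2 Pr g N xi (feedback Pi1 Sig1 x) (feedback Pi2 Sig2 x) =
  J1 Pr (swap_game g) N xi (feedback Pi2 Sig2 y) (feedback Pi1 Sig1 y).
Proof. by cbv zeta; rewrite cl_state_swap J1_swap. Qed.

(** Moments depend on the game through its noise alone, which both games share. *)
Lemma cmoment_swap j p q (Y : nat -> Omega -> 'M[R]_(p, q)) k :
  cmoment Pr (swap_game g) j Y k = cmoment Pr g j Y k.
Proof. by []. Qed.

Lemma Upsilon1_swap T k w : Upsilon1 Pr (swap_game g) T k w = Upsilon2 Pr g T k w.
Proof. by rewrite /Upsilon1 !cmoment_swap. Qed.

Lemma Phi1_swap T Sig1 phi k w :
  Phi1 Pr (swap_game g) T Sig1 phi k w = Phi2 Pr g T Sig1 phi k w.
Proof. by rewrite /Phi1 !cmoment_swap. Qed.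

Lemma Theta1_swap T Pi1 Sig1 phi k w :
  Theta1 Pr (swap_game g) T Pi1 Sig1 phi k w = Theta2 Pr g T Pi1 Sig1 phi k w.
Proof. by rewrite /Theta1 !cmoment_swap. Qed.

Lemma Delta1_swap T Pi1 k w :
  Delta1 Pr (swap_game g) T Pi1 k w = Delta2 Pr g T Pi1 k w.
Proof. by rewrite /Delta1 !cmoment_swap. Qed.

(** [Lambda1] and [Lambda2] list their two first-moment terms in opposite order, so commutativity of
    addition is called for. *)
Lemma Lambda1_swap T Pi1 k w :
  Lambda1 Pr (swap_game g) T Pi1 k w = Lambda2 Pr g T Pi1 k w.
Proof.
rewrite /Lambda1 /Lambda2 !cmoment_swap.
move: (cmoment Pr g 0 T k w) (cmoment Pr g 1 T k w) (cmoment Pr g 2 T k w).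
by move=> t0 t1 t2; congr (_ + _); rewrite addrAC.
Qed.

Lemma offset_swap T phi Sig1 k w : offset Pr (swap_game g) T phi Sig1 k w =
  2 * dotv (phi k.+1 w) (beta2 g Sig1 k w)
  - dotv (Phi2 Pr g T Sig1 phi k w)
      (invmx (Upsilon2 Pr g T k w) *m Phi2 Pr g T Sig1 phi k w)
  + dotv (T k.+1 w *m beta2 g Sig1 k w) (beta2 g Sig1 k w).
Proof. by rewrite /offset Upsilon1_swap Phi1_swap. Qed.

Lemma riccati1_swap T Pi1 Pi2 : riccati2 Pr g N T Pi1 Pi2 ->
  riccati1 Pr (swap_game g) N T Pi2 Pi1.
Proof.
move=> [ric TN]; split; last exact: TN.
move=> k kN; apply: filterS (ric k kN) => w.
by rewrite Lambda1_swap Upsilon1_swap Delta1_swap.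
Qed.

Lemma bsde1_swap T Pi1 phi Sig1 Sig2 : bsde2 Pr g N T Pi1 phi Sig1 Sig2 ->
  bsde1 Pr (swap_game g) N T Pi1 phi Sig2 Sig1.
Proof.
move=> [bs phiN]; split; last exact: phiN.
move=> k kN; apply: filterS (bs k kN) => w.
by rewrite Lambda1_swap Upsilon1_swap Theta1_swap Phi1_swap.
Qed.

Lemma assumption1_swap : assumption1 Pr g N -> assumption1 Pr (swap_game g) N.
Proof. by move=> [[? ? ?] [? ? ?] ? ?]; split. Qed.

End Swap.

Theorem theorem3p2 (R : realType) (d : measure_display)
    (Omega : measurableType d) (Pr : probability Omega R)
    (n m l N : nat) (g : lq_game R Omega n m l)
    (T1 T2 : nat -> Omega -> 'M[R]_n)
    (Pi1 : nat -> Omega -> 'M[R]_(m, n)) (Pi2 : nat -> Omega -> 'M[R]_(l, n))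
    (phi1 phi2 : nat -> Omega -> 'cV[R]_n)
    (Sig1 : nat -> Omega -> 'cV[R]_m) (Sig2 : nat -> Omega -> 'cV[R]_l)
    (N_ge1 : (1 <= N)%N)
    (Pr_complete : measure_is_complete Pr)
    (Hnoise : noise_assumption Pr g N)
    (H1 : assumption1 Pr g N)
    (H2 : assumption2 Pr g N)
    (H3 : assumption3 Pr g N)
    (T1_Linf : LinfF_psd Pr g N T1) (T2_Linf : LinfF_psd Pr g N T2)
    (Pi1_Linf : LinfF Pr g N Pi1) (Pi2_Linf : LinfF Pr g N Pi2)
    (Hriccati1 : riccati1 Pr g N T1 Pi1 Pi2)
    (Hriccati2 : riccati2 Pr g N T2 Pi1 Pi2)
    (Hregular : strongly_regular Pr g N T1 T2)
    (phi1_L2 : L2F Pr g N.+1 phi1) (phi2_L2 : L2F Pr g N.+1 phi2)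
    (Sig1_L2 : L2F Pr g N Sig1) (Sig2_L2 : L2F Pr g N Sig2)
    (Hbsde1 : bsde1 Pr g N T1 Pi2 phi1 Sig1 Sig2)
    (Hbsde2 : bsde2 Pr g N T2 Pi1 phi2 Sig1 Sig2) :
  [/\ closed_loop_nash Pr g N Pi1 Sig1 Pi2 Sig2,
      closed_loop_solvable Pr g N &
      forall xi : 'cV[R]_n,
        let x := cl_state g Pi1 Sig1 Pi2 Sig2 xi in
        let u := feedback Pi1 Sig1 x in
        let v := feedback Pi2 Sig2 x in
        [/\ forall k, (k < N)%N -> \forall w \ae Pr,
              [/\ u k w = Pi1 k w *m x k w + Sig1 k w,
                  u k w = - (invmx (Upsilon1 Pr g T1 k w) *m
                             (Lambda1 Pr g T1 Pi2 k w *m x k w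
                              + Phi1 Pr g T1 Sig2 phi1 k w)),
                  v k w = Pi2 k w *m x k w + Sig2 k w &
                  v k w = - (invmx (Upsilon2 Pr g T2 k w) *m
                             (Lambda2 Pr g T2 Pi1 k w *m x k w
                              + Phi2 Pr g T2 Sig1 phi2 k w))],
            L2F Pr g N.+1 x,
            (forall w, x 0%N w = xi) /\
            (forall k, (k < N)%N -> \forall w \ae Pr,
              x k.+1 w =
                (cA g k w + cB g k w *m Pi1 k w + cC g k w *m Pi2 k w) *m x k w
                + cB g k w *m Sig1 k w + cC g k w *m Sig2 k w + cb g k w
                + noise g k w *:
                  ((cD g k w + cE g k w *m Pi1 k w + cF g k w *m Pi2 k w)
                     *m x k w
                   + cE g k w *m Sig1 k w + cF g k w *m Sig2 k w
                   + csigma g k w)),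
            J1 Pr g N xi u v =
              ((2^-1)%:E * 'E_Pr[(fun w =>
                 dotv (phi1 0%N w) xi + dotv (T1 0%N w *m xi + phi1 0%N w) xi +
                 \sum_(k < N)
                   (2 * dotv (phi1 k.+1 w) (beta1 g Sig2 k w)
                    - dotv (Phi1 Pr g T1 Sig2 phi1 k w)
                        (invmx (Upsilon1 Pr g T1 k w)
                           *m Phi1 Pr g T1 Sig2 phi1 k w)
                    + dotv (T1 k.+1 w *m beta1 g Sig2 k w)
                        (beta1 g Sig2 k w)))%R])%E &
            J2 Pr g N xi u v =
              ((2^-1)%:E * 'E_Pr[(fun w =>
                 dotv (phi2 0%N w) xi + dotv (T2 0%N w *m xi + phi2 0%N w) xi +
                 \sum_(k < N)
                   (2 * dotv (phi2 k.+1 w) (beta2 g Sig1 k w)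
                    - dotv (Phi2 Pr g T2 Sig1 phi2 k w)
                        (invmx (Upsilon2 Pr g T2 k w)
                           *m Phi2 Pr g T2 Sig1 phi2 k w)
                    + dotv (T2 k.+1 w *m beta2 g Sig1 k w)
                        (beta2 g Sig1 k w)))%R])%E]].
Proof.
have [[HQ HL HR] [HP HM HS] _ _ [Hq Hrho Hp Hth]] := H2.
have st1 : strategy Pr g N Pi1 Sig1 by [].
have st2 : strategy Pr g N Pi2 Sig2 by [].
have [delta d0 reg] := Hregular.
have reg1 : exists2 delta : R, 0 < delta & forall k, (k < N)%N ->
    \forall w \ae Pr, pdmx (Upsilon1 Pr g T1 k w - delta%:M).
  by exists delta => // k kN; apply: filterS (reg k kN) => w [].
have reg2 : exists2 delta : R, 0 < delta & forall k, (k < N)%N ->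
    \forall w \ae Pr, pdmx (Upsilon1 Pr (swap_game g) T2 k w - delta%:M).
  by exists delta => // k kN; apply: filterS (reg k kN) => w [].
have ver1 := player1_verification Pr_complete Hnoise H1 HQ HL HR Hq Hrho st1 st2
  T1_Linf phi1_L2 Hriccati1 Hbsde1 reg1.
have dev1 := feedback_deviation_eq0 Hriccati1 Hbsde1.
have ric2 := riccati1_swap Hriccati2; have bs2 := bsde1_swap Hbsde2.
(* The exchanged game has the same noise, hence the same filtration and process spaces, so the
   hypotheses on these are accepted by conversion. *)
have ver2 := player1_verification (g := swap_game g) Pr_complete Hnoise
  (assumption1_swap H1) HP HM HS Hp Hth st2 st1 T2_Linf phi2_L2 ric2 bs2 reg2.
have dev2 := feedback_deviation_eq0 ric2 bs2.
have val1 xi := (ver1 xi _ _ st1).2 (dev1 _).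
have val2 xi := (ver2 xi _ _ st2).2 (dev2 _).
have nash : closed_loop_nash Pr g N Pi1 Sig1 Pi2 Sig2.
  split=> // xi x u v; split=> [Pi1' Sig1' s1'|Pi2' Sig2' s2']; cbv zeta.
    (* The candidate's cost is exactly the bound that lies below the cost of every competitor. *)
    by rewrite val1; exact: (ver1 xi _ _ s1').1.
  by rewrite !J2_feedback_swap val2; exact: (ver2 xi _ _ s2').1.
split=> //; first by exists Pi1, Sig1, Pi2, Sig2.
move=> xi x u v; split.
- move=> k kN.
  have {}dev1 := dev1 x k kN; have {}dev2 := dev2 x k kN.
  (* The feedback representations are the vanishing of the deviations, solved for u and v. *)
  apply: filterS2 dev1 dev2 => w dev1 dev2; split=> //.
    by apply/eqP; rewrite -addr_eq0; exact/eqP.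
  by apply/eqP; rewrite -addr_eq0 -Lambda1_swap; exact/eqP.
- apply: sqintegrable_L2F => k kN.
    by case: (cl_state_adapted Hnoise H1 st1 st2 xi kN).
  by case: (cl_state_adapted Hnoise H1 st1 st2 xi kN).
- split=> // k kN; apply: aeW => w.
  have E (A : 'M[R]_n) p q (B : 'M[R]_(n, p)) (C : 'M[R]_(n, q)) P1 P2 y s1 s2 b :
      A *m y + B *m (P1 *m y + s1) + C *m (P2 *m y + s2) + b =
      (A + B *m P1 + C *m P2) *m y + B *m s1 + C *m s2 + b.
    rewrite !mulmxDr !mulmxDl !mulmxA !addrA; congr (_ + _ + _).
    by rewrite addrAC.
  by rewrite -!E.
- exact: val1.
- rewrite J2_feedback_swap val2 /optimal_value.
  by under eq_fun do under eq_bigr do rewrite offset_swap.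
Qed.
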